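(* Let $M$ be a monoid and let $\varphi\colon A\to M$ be a homomorphism from a submonoid $A$ of $M$. Let $L=\langle M,t\mid at=t\varphi(a),\ a\in A\rangle$ be the Otto-Pride extension. Suppose that $\mathbb ZM$ is flat as a right $\mathbb ZA$-module (via right multiplication), and let $1\le n\le\infty$. If $M$ is of type left-$\mathrm{FP}_n$ and $A$ is of type left-$\mathrm{FP}_{n-1}$, then $L$ is of type left-$\mathrm{FP}_n$.
   Context: Convention: $\infty-1=\infty$. The Otto-Pride extension $L$ is the quotient of the monoid free product $M\ast\{t\}^*$ (with $\{t\}^*$ the free monoid on $t$) by the smallest congruence such that $at=t\varphi(a)$ for all $a\in A$. A monoid $N$ is of type left-$\mathrm{FP}_n$ ($0\le n\le\infty$) if the trivial left $\mathbb ZN$-module $\mathbb Z$ has a projective resolution $(P_i)_{i\ge0}$ with $P_i$ finitely generated for all $i\leq n$ (for all $i$ if $n=\infty$). *)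

(* Defs.v *)
(* Everything is built on MathComp; boolp (classical logic) is only used to     *)
(* form quotients by Prop-valued equivalences.                                  *)
From HB Require Import structures.
From mathcomp Require Import all_boot all_algebra.
From mathcomp Require Import finmap boolp.
From mathcomp.multinomials Require Import monalg.

Set Implicit Arguments.
Unset Strict Implicit.
Unset Printing Implicit Defensive.

Import GRing.Theory.

Local Open Scope quotient_scope.
Local Open Scope fset_scope.
Local Open Scope ring_scope.

Notation "{ 'monhom' M '->' N }" := (UMagmaMorphism.type M%type N%type)
  (at level 0, M at level 98, N at level 99,
   format "{ 'monhom'  M  ->  N }") : type_scope.

Section MonoidQuotient.
Variables (N : monoidType) (R : N -> N -> Prop).

Inductive congruence_gen : N -> N -> Prop :=
| cg_rel x y : R x y -> congruence_gen x y
| cg_refl x : congruence_gen x x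
| cg_sym x y : congruence_gen x y -> congruence_gen y x
| cg_trans x y z :
    congruence_gen x y -> congruence_gen y z -> congruence_gen x z
| cg_mul x x' y y' : congruence_gen x x' -> congruence_gen y y' ->
    congruence_gen (x * y)%g (x' * y')%g.

Definition congruence_genb : rel N := fun x y => `[< congruence_gen x y >].

Lemma congruence_genb_equiv : equiv_class_of congruence_genb.
Proof.
split=> [x|x y|y x z].
- exact/asboolP/cg_refl.
- by apply/asboolP/asboolP => /cg_sym.
- by move=> /asboolP xy /asboolP yz; exact/asboolP/(cg_trans xy yz).
Qed.

Canonical congruence_gen_equiv := EquivRelPack congruence_genb_equiv.
Canonical congruence_gen_encModRel := defaultEncModRel congruence_genb.

Definition monoid_quot : Type := {eq_quot congruence_genb}.

HB.instance Definition _ := EqQuotient.on monoid_quot.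
HB.instance Definition _ := Choice.on monoid_quot.

Definition monoid_pi (x : N) : monoid_quot := \pi_monoid_quot x.

Lemma monoid_piP x y : monoid_pi x = monoid_pi y <-> congruence_gen x y.
Proof.
split=> [/eqP|xy]; rewrite /monoid_pi; first by rewrite eqmodE => /asboolP.
by apply/eqP; rewrite eqmodE; apply/asboolP.
Qed.

Lemma monoid_pi_repr (x : monoid_quot) : monoid_pi (repr x) = x.
Proof. exact: reprK. Qed.

Definition monoid_quot_mul (x y : monoid_quot) : monoid_quot :=
  monoid_pi (repr x * repr y)%g.

Lemma monoid_quot_mulE x y :
  monoid_quot_mul (monoid_pi x) (monoid_pi y) = monoid_pi (x * y)%g.
Proof. by apply/monoid_piP/cg_mul; apply/monoid_piP; rewrite monoid_pi_repr. Qed.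

Lemma monoid_quot_mulA : associative monoid_quot_mul.
Proof.
move=> x y z; rewrite -[x]monoid_pi_repr -[y]monoid_pi_repr -[z]monoid_pi_repr.
by rewrite !monoid_quot_mulE mulgA.
Qed.

Lemma monoid_quot_mul1 : left_id (monoid_pi 1%g) monoid_quot_mul.
Proof.
by move=> x; rewrite -[x]monoid_pi_repr monoid_quot_mulE mul1g.
Qed.

Lemma monoid_quot_mulr1 : right_id (monoid_pi 1%g) monoid_quot_mul.
Proof.
by move=> x; rewrite -[x]monoid_pi_repr monoid_quot_mulE mulg1.
Qed.

HB.instance Definition _ := isMonoid.Build monoid_quot
  monoid_quot_mulA monoid_quot_mul1 monoid_quot_mulr1.

Lemma monoid_pi_morphism : monoid.monoid_morphism monoid_pi.
Proof. by split=> // x y; rewrite [RHS]monoid_quot_mulE. Qed.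

HB.instance Definition _ :=
  isUMagmaMorphism.Build N monoid_quot monoid_pi monoid_pi_morphism.

End MonoidQuotient.

Definition free_monoid (T : Type) : Type := seq T.

HB.instance Definition _ (T : choiceType) := Choice.on (free_monoid T).
HB.instance Definition _ (T : choiceType) :=
  isMonoid.Build (free_monoid T) (@catA T) (@cat0s T) (@cats0 T).

Section FreeProduct.
Variables M N : monoidType.

(* The free product is the quotient of the monoid of words in the disjoint      *)
(* union of M and N by the multiplication tables of M and N.                    *)
Variant free_product_rel : free_monoid (M + N) -> free_monoid (M + N) -> Prop :=
| fp_one_l : free_product_rel [:: inl 1%g] [::]
| fp_one_r : free_product_rel [:: inr 1%g] [::]
| fp_mul_l x y : free_product_rel [:: inl x; inl y] [:: inl (x * y)%g]
| fp_mul_r x y : free_product_rel [:: inr x; inr y] [:: inr (x * y)%g].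

Definition free_product : Type := monoid_quot free_product_rel.

HB.instance Definition _ := Monoid.on free_product.

Definition free_product_inl (x : M) : free_product :=
  monoid_pi free_product_rel [:: inl x].

Definition free_product_inr (x : N) : free_product :=
  monoid_pi free_product_rel [:: inr x].

Lemma free_product_inl_morphism : monoid.monoid_morphism free_product_inl.
Proof.
split=> [|x y]; first exact/monoid_piP/cg_rel/fp_one_l.
rewrite /free_product_inl -gmulfM; exact/monoid_piP/cg_sym/cg_rel/fp_mul_l.
Qed.

HB.instance Definition _ := isUMagmaMorphism.Build M free_product
  free_product_inl free_product_inl_morphism.

Lemma free_product_inr_morphism : monoid.monoid_morphism free_product_inr.
Proof.
split=> [|x y]; first exact/monoid_piP/cg_rel/fp_one_r.
rewrite /free_product_inr -gmulfM; exact/monoid_piP/cg_sym/cg_rel/fp_mul_r.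
Qed.

HB.instance Definition _ := isUMagmaMorphism.Build N free_product
  free_product_inr free_product_inr_morphism.

End FreeProduct.

Section OttoPride.
Variables (M : monoidType) (S : pred M) (A : subMonoidType S).
Variable phi : {monhom A -> M}.

Local Notation F := (free_product M (free_monoid unit)).

Definition op_t : F := free_product_inr M ([:: tt] : free_monoid unit).

(* The inclusion of the submonoid A in M is val : A -> M. *)
Variant otto_pride_rel : F -> F -> Prop :=
| op_rel (a : A) :
    otto_pride_rel (free_product_inl _ (val a) * op_t)%g
                   (op_t * free_product_inl _ (phi a))%g.

Definition otto_pride : Type := monoid_quot otto_pride_rel.

HB.instance Definition _ := Monoid.on otto_pride.

End OttoPride.

Section FreeAbelianLift.
Variables (K : choiceType) (V : zmodType) (f : K -> V).

Definition malg_lift (g : {malg int[K]}) : V := \sum_(k <- msupp g) f k *~ g@_k.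

Lemma malg_liftw (d : {fset K}) g : msupp g `<=` d ->
  malg_lift g = \sum_(k <- d) f k *~ g@_k.
Proof.
move=> le_d; apply: big_fset_incl => // k _ /mcoeff_outdom ->.
by rewrite mulr0z.
Qed.

Lemma malg_lift_is_zmod_morphism : zmod_morphism malg_lift.
Proof.
move=> g h.
rewrite (malg_liftw (msuppB_le g h)) (malg_liftw (fsubsetUl _ (msupp h))).
rewrite (malg_liftw (fsubsetUr (msupp g) _)) -sumrB; apply: eq_bigr => k _.
by rewrite mcoeffB mulrzBr.
Qed.

HB.instance Definition _ := GRing.isZmodMorphism.Build {malg int[K]} V malg_lift
  malg_lift_is_zmod_morphism.

Lemma malg_liftU c k : malg_lift << c *g k >> = f k *~ c.
Proof. by rewrite (malg_liftw msuppU_le) big_seq_fset1 mcoeffUU. Qed.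

Lemma malg_liftU1 k : malg_lift << k >> = f k.
Proof. by rewrite malg_liftU mulr1z. Qed.

End FreeAbelianLift.

Lemma malgU_int (K : choiceType) (c : int) (k : K) :
  << c *g k >> = << k >> *~ c :> {malg int[K]}.
Proof. by rewrite -[c in LHS]intz raddfMz. Qed.

Lemma malg_zmod_ind (K : choiceType) (P : {malg int[K]} -> Prop) :
    P 0 -> (forall x y, P x -> P y -> P (x - y)) -> (forall k, P << k >>) ->
  forall x, P x.
Proof.
move=> P0 PB PU x.
have PN y : P y -> P (- y) by move=> Py; rewrite -sub0r; exact: PB.
have PD y z : P y -> P z -> P (y + z).
  by move=> Py Pz; rewrite -[z]opprK; exact/PB/PN.
have PM y n : P y -> P (y *+ n).
  by move=> Py; elim: n => [|n Pn]; rewrite ?mulr0n ?mulrS //; apply: PD.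
rewrite [x]monalgE; apply: big_ind => // k _; rewrite malgU_int.
by case: (_@__) => n; [exact: PM|exact/PN/PM].
Qed.

(* The ring instance of {malg int[K]} is only available for monoids K in which  *)
(* 1 is the only unit, hence the following alias for arbitrary monoids.         *)
Definition monoid_ring (N : monoidType) : Type := {malg int[N]}.

Section MonoidRing.
Variable N : monoidType.

HB.instance Definition _ := GRing.Zmodule.on (monoid_ring N).

Implicit Types x y z : monoid_ring N.

Definition monoid_ring_mul x y : monoid_ring N :=
  \sum_(a <- msupp x) \sum_(b <- msupp y) << x@_a * y@_b *g (a * b)%g >>.

Definition monoid_ring_one : monoid_ring N := << 1%g >>.

Lemma monoid_ring_mulE x y : monoid_ring_mul x y =
  malg_lift (fun a => malg_lift (fun b => << (a * b)%g >>) y) x.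
Proof.
apply: eq_bigr => a _; rewrite /malg_lift mulrz_suml; apply: eq_bigr => b _.
by rewrite malgU_int mulrC mulrzA.
Qed.

Lemma monoid_ring_mulUU (a b : N) :
  monoid_ring_mul << a >> << b >> = << (a * b)%g >>.
Proof. by rewrite monoid_ring_mulE !malg_liftU1. Qed.

Lemma monoid_ring_mulBl x y z :
  monoid_ring_mul (x - y) z = monoid_ring_mul x z - monoid_ring_mul y z.
Proof. by rewrite !monoid_ring_mulE raddfB. Qed.

Lemma monoid_ring_mulBr x y z :
  monoid_ring_mul x (y - z) = monoid_ring_mul x y - monoid_ring_mul x z.
Proof.
rewrite !monoid_ring_mulE /malg_lift -sumrB; apply: eq_bigr => a _.
by rewrite -/(malg_lift _ _) raddfB mulrzBl.
Qed.

Lemma monoid_ring_mul0l y : monoid_ring_mul 0 y = 0.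
Proof. by have := monoid_ring_mulBl 0 0 y; rewrite !subrr. Qed.

Lemma monoid_ring_mulr0 x : monoid_ring_mul x 0 = 0.
Proof. by have := monoid_ring_mulBr x 0 0; rewrite !subrr. Qed.

Lemma monoid_ring_mulDl : left_distributive monoid_ring_mul +%R.
Proof.
move=> x y z; rewrite -[y in LHS]opprK monoid_ring_mulBl.
by rewrite -[- y]sub0r monoid_ring_mulBl monoid_ring_mul0l sub0r opprK.
Qed.

Lemma monoid_ring_mulDr : right_distributive monoid_ring_mul +%R.
Proof.
move=> x y z; rewrite -[z in LHS]opprK monoid_ring_mulBr.
by rewrite -[- z]sub0r monoid_ring_mulBr monoid_ring_mulr0 sub0r opprK.
Qed.

Lemma monoid_ring_mulA : associative monoid_ring_mul.
Proof.
move=> x y z; elim/malg_zmod_ind: x => [|x x' IH IH'|a].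
- by rewrite !monoid_ring_mul0l.
- by rewrite !monoid_ring_mulBl IH IH'.
elim/malg_zmod_ind: y => [|y y' IH IH'|b].
- by rewrite monoid_ring_mulr0 !monoid_ring_mul0l monoid_ring_mulr0.
- by rewrite monoid_ring_mulBr !monoid_ring_mulBl monoid_ring_mulBr IH IH'.
elim/malg_zmod_ind: z => [|z z' IH IH'|c].
- by rewrite !monoid_ring_mulr0.
- by rewrite !monoid_ring_mulBr IH IH'.
by rewrite !monoid_ring_mulUU mulgA.
Qed.

Lemma monoid_ring_mul1 : left_id monoid_ring_one monoid_ring_mul.
Proof.
move=> x; elim/malg_zmod_ind: x => [|x x' IH IH'|a].
- by rewrite monoid_ring_mulr0.
- by rewrite monoid_ring_mulBr IH IH'.
by rewrite monoid_ring_mulUU mul1g.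
Qed.

Lemma monoid_ring_mulr1 : right_id monoid_ring_one monoid_ring_mul.
Proof.
move=> x; elim/malg_zmod_ind: x => [|x x' IH IH'|a].
- by rewrite monoid_ring_mul0l.
- by rewrite monoid_ring_mulBl IH IH'.
by rewrite monoid_ring_mulUU mulg1.
Qed.

Lemma monoid_ring_one_neq0 : monoid_ring_one != 0.
Proof. by rewrite monalgU_eq0. Qed.

HB.instance Definition _ := GRing.Zmodule_isNzRing.Build (monoid_ring N)
  monoid_ring_mulA monoid_ring_mul1 monoid_ring_mulr1
  monoid_ring_mulDl monoid_ring_mulDr monoid_ring_one_neq0.

End MonoidRing.

Section MonoidRingLift.
Variables (N : monoidType) (S : nzRingType) (f : N -> S).
Hypothesis f1 : f 1%g = 1.
Hypothesis fM : forall a b, f (a * b)%g = f a * f b.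

Lemma malg_lift_monoid_morphism :
  monoid_morphism (malg_lift f : monoid_ring N -> S).
Proof.
set F : monoid_ring N -> S := malg_lift f.
have F0 : F 0 = 0 by exact: raddf0.
have FB x y : F (x - y) = F x - F y by exact: raddfB.
split=> [|x y]; first by rewrite -f1; exact: malg_liftU1.
elim/malg_zmod_ind: x => [|x x' IH IH'|a].
- by rewrite mul0r F0 mul0r.
- by rewrite mulrBl !FB mulrBl IH IH'.
elim/malg_zmod_ind: y => [|y y' IH IH'|b].
- by rewrite mulr0 F0 mulr0.
- by rewrite mulrBr !FB mulrBr IH IH'.
by rewrite [_ * _]monoid_ring_mulUU /F !malg_liftU1 fM.
Qed.

End MonoidRingLift.

Section MonoidRingMap.
Variables (M N : monoidType) (f : {monhom M -> N}).

Definition monoid_ring_map (x : monoid_ring M) : monoid_ring N :=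
  malg_lift (fun a => << f a >> : monoid_ring N) x.

HB.instance Definition _ :=
  GRing.Additive.copy monoid_ring_map
    (malg_lift (fun a => << f a >> : monoid_ring N)).

Lemma monoid_ring_map_monoid_morphism : monoid_morphism monoid_ring_map.
Proof.
apply: malg_lift_monoid_morphism => [|a b]; first by rewrite gmulf1.
by rewrite gmulfM [RHS]monoid_ring_mulUU.
Qed.

HB.instance Definition _ := GRing.isMonoidMorphism.Build
  (monoid_ring M) (monoid_ring N) monoid_ring_map
  monoid_ring_map_monoid_morphism.

End MonoidRingMap.

Section Augmentation.
Variable N : monoidType.

Definition augmentation (x : monoid_ring N) : int := malg_lift (fun=> 1) x.

HB.instance Definition _ :=
  GRing.Additive.copy augmentation (malg_lift (fun _ : N => 1 : int)).

Lemma augmentation_monoid_morphism : monoid_morphism augmentation.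
Proof.
by apply: malg_lift_monoid_morphism => // a b; rewrite mulr1.
Qed.

HB.instance Definition _ := GRing.isMonoidMorphism.Build
  (monoid_ring N) int augmentation augmentation_monoid_morphism.

End Augmentation.

(* The trivial left module: every element of N acts as the identity on int.     *)
Definition trivial_module (N : monoidType) : Type := int.

Section TrivialModule.
Variable N : monoidType.

HB.instance Definition _ := GRing.Zmodule.on (trivial_module N).

Definition trivial_scale (r : monoid_ring N) (z : trivial_module N) :
  trivial_module N := (augmentation r * (z : int) : int).

Lemma trivial_scaleA a b z :
  trivial_scale a (trivial_scale b z) = trivial_scale (a * b) z.
Proof. by rewrite /trivial_scale rmorphM mulrA. Qed.

Lemma trivial_scale1 : left_id 1 trivial_scale.
Proof. by move=> z; rewrite /trivial_scale rmorph1 mul1r. Qed.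

Lemma trivial_scaleDr : right_distributive trivial_scale +%R.
Proof. by move=> r y z; rewrite /trivial_scale mulrDr. Qed.

Lemma trivial_scaleDl z : {morph trivial_scale^~ z : a b / a + b}.
Proof. by move=> a b; rewrite /trivial_scale rmorphD mulrDl. Qed.

HB.instance Definition _ := GRing.Zmodule_isLmodule.Build
  (monoid_ring N) (trivial_module N)
  trivial_scaleA trivial_scale1 trivial_scaleDr trivial_scaleDl.

End TrivialModule.

(* The ring S as a right R-module along f : R -> S, i.e. x . r = x * f r.       *)
Definition right_module_along (R S : pzRingType) (f : {rmorphism R -> S}) :
  Type := S.

Section RightModuleAlong.
Variables (R S : pzRingType) (f : {rmorphism R -> S}).

HB.instance Definition _ := GRing.Zmodule.on (right_module_along f).

Definition along_scale (r : R^c) (x : right_module_along f) :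
  right_module_along f := (x : S) * f r.

Lemma along_scaleA a b x :
  along_scale a (along_scale b x) = along_scale (a * b) x.
Proof. by rewrite /along_scale -mulrA -rmorphM. Qed.

Lemma along_scale1 : left_id 1 along_scale.
Proof. by move=> x; rewrite /along_scale rmorph1 mulr1. Qed.

Lemma along_scaleDr : right_distributive along_scale +%R.
Proof. by move=> r x y; rewrite /along_scale mulrDl. Qed.

Lemma along_scaleDl x : {morph along_scale^~ x : a b / a + b}.
Proof. by move=> a b; rewrite /along_scale rmorphD mulrDr. Qed.

HB.instance Definition _ := GRing.Zmodule_isLmodule.Build
  R^c (right_module_along f)
  along_scaleA along_scale1 along_scaleDr along_scaleDl.

End RightModuleAlong.

(* Right R-modules are left modules over the converse ring R^c.                 *)
Section Tensor.
Variables (R : pzRingType) (X : lmodType R^c) (Y : lmodType R).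

Local Notation FXY := {malg int[(X * Y)%type]}.

(* The subgroup of the free abelian group on X * Y to be quotiented out.        *)
Inductive tensor_rel : FXY -> Prop :=
| tr_zero : tensor_rel 0
| tr_sub u v : tensor_rel u -> tensor_rel v -> tensor_rel (u - v)
| tr_addl x x' y :
    tensor_rel (<< (x + x', y) >> - << (x, y) >> - << (x', y) >>)
| tr_addr x y y' :
    tensor_rel (<< (x, y + y') >> - << (x, y) >> - << (x, y') >>)
| tr_balanced x (r : R) y :
    tensor_rel (<< ((r : R^c) *: x, y) >> - << (x, r *: y) >>).

Definition tensor_relb : pred FXY := fun u => `[< tensor_rel u >].

Lemma tensor_relb_closed : zmod_closed tensor_relb.
Proof.
split=> [|u v /asboolP ru /asboolP rv]; apply/asboolP; first exact: tr_zero.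
exact: tr_sub.
Qed.

HB.instance Definition _ :=
  GRing.isZmodClosed.Build FXY tensor_relb tensor_relb_closed.

Definition tensor : Type :=
  Quotient.quot (GRing.ZmodClosed.clone FXY tensor_relb _).

HB.instance Definition _ := GRing.Zmodule.on tensor.
HB.instance Definition _ := EqQuotient.on tensor.

Definition tensor_pi (u : FXY) : tensor := \pi_tensor u.

Definition pure (x : X) (y : Y) : tensor := tensor_pi << (x, y) >>.

Lemma tensor_pi_is_zmod_morphism : zmod_morphism tensor_pi.
Proof. exact: (pi_is_zmod_morphism tensor). Qed.

HB.instance Definition _ := GRing.isZmodMorphism.Build FXY tensor
  tensor_pi tensor_pi_is_zmod_morphism.

Lemma tensor_pi_repr (u : tensor) : tensor_pi (repr u) = u.
Proof. exact: reprK. Qed.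

Lemma tensor_pi_eq0 u : tensor_pi u = 0 <-> tensor_rel u.
Proof.
rewrite -(raddf0 tensor_pi); split => [/eqP|ru].
  by rewrite -[_ == _]Quotient.idealrBE subr0 => /asboolP.
by apply/eqP; rewrite -[_ == _]Quotient.idealrBE subr0; apply/asboolP.
Qed.

Lemma pureDl x x' y : pure (x + x') y = pure x y + pure x' y.
Proof.
rewrite /pure; apply/eqP; rewrite -subr_eq0 opprD addrA -!raddfB /=; apply/eqP.
exact/tensor_pi_eq0/tr_addl.
Qed.

Lemma pureDr x y y' : pure x (y + y') = pure x y + pure x y'.
Proof.
rewrite /pure; apply/eqP; rewrite -subr_eq0 opprD addrA -!raddfB /=; apply/eqP.
exact/tensor_pi_eq0/tr_addr.
Qed.

Lemma pure_balanced x (r : R) y : pure ((r : R^c) *: x) y = pure x (r *: y).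
Proof.
rewrite /pure; apply/eqP; rewrite -subr_eq0 -raddfB /=; apply/eqP.
exact/tensor_pi_eq0/tr_balanced.
Qed.

Section Lift.
Variables (V : zmodType) (f : X -> Y -> V).

(* Meaningful when f is biadditive and balanced.                                *)
Definition tensor_lift (u : tensor) : V :=
  malg_lift (fun p => f p.1 p.2) (repr u).

Hypothesis fDl : forall x x' y, f (x + x') y = f x y + f x' y.
Hypothesis fDr : forall x y y', f x (y + y') = f x y + f x y'.
Hypothesis fbal : forall x (r : R) y, f ((r : R^c) *: x) y = f x (r *: y).

Lemma tensor_lift_pi u :
  tensor_lift (tensor_pi u) = malg_lift (fun p => f p.1 p.2) u.
Proof.
rewrite /tensor_lift; set F := malg_lift _.
have FB v w : F (v - w) = F v - F w by exact: raddfB.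
have F0 : F 0 = 0 by exact: raddf0.
have FU x y : F << (x, y) >> = f x y by exact: malg_liftU1.
apply/eqP; rewrite -subr_eq0 -FB; apply/eqP.
have: tensor_rel (repr (tensor_pi u) - u).
  by apply/tensor_pi_eq0; rewrite raddfB /= tensor_pi_repr subrr.
elim=> [|v w _ Fv _ Fw|x x' y|x y y'|x r y] //.
- by rewrite FB Fv Fw subrr.
- by rewrite !FB !FU fDl -addrA -opprD subrr.
- by rewrite !FB !FU fDr -addrA -opprD subrr.
- by rewrite FB !FU fbal subrr.
Qed.

Lemma tensor_lift_pure x y : tensor_lift (pure x y) = f x y.
Proof. by rewrite tensor_lift_pi malg_liftU1. Qed.

Lemma tensor_lift_zmod_morphism : zmod_morphism tensor_lift.
Proof.
move=> u v; rewrite -[u]tensor_pi_repr -[v]tensor_pi_repr -raddfB.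
by rewrite !tensor_lift_pi; exact: raddfB.
Qed.

End Lift.

End Tensor.

Section TensorMap.
Variables (R : pzRingType) (X : lmodType R^c) (Y Y' : lmodType R).
Variable g : {linear Y -> Y'}.

Definition tensor_map : tensor X Y -> tensor X Y' :=
  tensor_lift (fun x y => pure x (g y)).

Lemma tensor_map_pure x y : tensor_map (pure x y) = pure x (g y).
Proof.
by apply: tensor_lift_pure => *; rewrite ?linearD ?linearZ /=
  ?pureDl ?pureDr ?pure_balanced.
Qed.

Lemma tensor_map_is_zmod_morphism : zmod_morphism tensor_map.
Proof.
by apply: tensor_lift_zmod_morphism => *; rewrite ?linearD ?linearZ /=
  ?pureDl ?pureDr ?pure_balanced.
Qed.

HB.instance Definition _ := GRing.isZmodMorphism.Build
  (tensor X Y) (tensor X Y') tensor_map tensor_map_is_zmod_morphism.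

End TensorMap.

Arguments tensor_map {R} X {Y Y'} g u.

Definition surjective_map (X Y : Type) (f : X -> Y) : Prop :=
  forall y, exists x, f x = y.

Definition exact_at (X : Type) (Y Z : zmodType) (f : X -> Y) (g : Y -> Z) :
  Prop := forall y, g y = 0 <-> exists x, f x = y.

(* Flatness as exactness of the functor X (x)_R - on left R-modules.            *)
Definition flat (R : pzRingType) (X : lmodType R^c) : Prop :=
  forall (Y1 Y2 Y3 : lmodType R) (f : {linear Y1 -> Y2}) (g : {linear Y2 -> Y3}),
    exact_at f g -> exact_at (tensor_map X f) (tensor_map X g).

Definition projective (R : pzRingType) (P : lmodType R) : Prop :=
  forall (X Y : lmodType R) (f : {linear X -> Y}) (g : {linear P -> Y}),
    surjective_map f -> exists h : {linear P -> X}, forall p, f (h p) = g p.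

Definition finitely_generated (R : pzRingType) (P : lmodType R) : Prop :=
  exists s : seq P, forall x, exists c : 'I_(size s) -> R,
    x = \sum_(i < size s) c i *: s`_i.

Definition projective_resolution (R : pzRingType) (W : lmodType R)
    (P : nat -> lmodType R) (d : forall i, {linear P i.+1 -> P i})
    (e : {linear P 0%N -> W}) : Prop :=
  [/\ forall i, projective (P i),
      surjective_map e,
      exact_at (d 0%N) e &
      forall i, exact_at (d i.+1) (d i)].

(* n with 0 <= n <= oo; note that natbar_pred Infty = Infty.                     *)
Variant natbar := Fin of nat | Infty.

Definition le_natbar (i : nat) (n : natbar) : bool :=
  if n is Fin m then (i <= m)%N else true.

Definition natbar_pred (n : natbar) : natbar :=
  if n is Fin m then Fin m.-1 else Infty.

Definition left_FP (n : natbar) (N : monoidType) : Prop :=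
  exists (P : nat -> lmodType (monoid_ring N))
         (d : forall i, {linear P i.+1 -> P i})
         (e : {linear P 0%N -> trivial_module N}),
    projective_resolution d e /\
    forall i, le_natbar i n -> finitely_generated (P i).

(* Main.v *)
From HB Require Import structures.
Require Import Defs.
From mathcomp Require Import all_boot all_algebra.
From mathcomp Require Import boolp.
From mathcomp.multinomials Require Import monalg.

(* Write R = ZM, B = ZA, and T W = R (x)_B W for an R-module W on which B acts
   through phi.  A ZL-module is the same thing as an R-module V together with an
   R-linear map T V -> V, namely x (x) v |-> x t v; so ZL behaves like a tensor
   algebra, and the ZL-module free on an R-module W is F W = (+)_k T^k W.  Since
   R is flat over B, T and hence F are exact; moreover F preserves projective
   modules and finite generation.  Every ZL-module V sits in a short exact
   sequence 0 -> F (T V) -> F V -> V -> 0.  For V = Z, applying F to a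
   resolution of Z over R resolves the middle term, and applying F (R (x)_B -)
   to a resolution of Z over B resolves the left one; the mapping cone of a
   comparison map between the two resolves Z over ZL, the left resolution being
   shifted by one degree.  This needs no normal form for the elements of L. *)

Set Implicit Arguments.
Unset Strict Implicit.
Unset Printing Implicit Defensive.

Import GRing.Theory.

Local Open Scope ring_scope.

(** * Submodules, pullbacks, projective modules and spans *)

Definition linear_pack (R : pzRingType) (U V : lmodType R) (f : U -> V)
    (fL : linear f) : {linear U -> V} :=
  HB.pack f (GRing.isLinear.Build R U V *:%R f fL).

Definition submodule (R : pzRingType) (V : lmodType R) (P : V -> Prop) : Prop :=
  P 0 /\ forall a x y, P x -> P y -> P (a *: x + y).

Section Submodule.
Variables (R : pzRingType) (V : lmodType R) (P : V -> Prop).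
Hypothesis subP : submodule P.

Lemma submodule0 : P 0. Proof. by case: subP. Qed.

Lemma submoduleD x y : P x -> P y -> P (x + y).
Proof. by case: subP => _ PL Px Py; rewrite -[x]scale1r; exact: PL. Qed.

Lemma submoduleZ a x : P x -> P (a *: x).
Proof. by case: subP => P0 PL Px; rewrite -[_ *: x]addr0; exact: PL. Qed.

Lemma submoduleB x y : P x -> P y -> P (x - y).
Proof.
by move=> Px Py; rewrite -scaleN1r; apply: submoduleD => //; apply: submoduleZ.
Qed.

End Submodule.

Section Projective.
Variable R : pzRingType.

Section Pullback.
Variables (Q X Y : lmodType R) (h : {linear Q -> Y}) (d : {linear X -> Y}).

Definition pullback_pred : pred (Q * X)%type := fun p => h p.1 == d p.2.

Lemma pullback_submod_closed : submod_closed pullback_pred.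
Proof.
split=> [|a p q]; rewrite /pullback_pred !unfold_in /=.
  by rewrite !linear0.
by move=> /eqP hp /eqP hq; rewrite !linearP hp hq.
Qed.

HB.instance Definition _ :=
  GRing.isSubmodClosed.Build R (Q * X)%type pullback_pred pullback_submod_closed.

Record pullback :=
  Pullback {pullback_val :> Q * X; _ : pullback_pred pullback_val}.

HB.instance Definition _ := [isSub for pullback_val].
HB.instance Definition _ := [Choice of pullback by <:].
HB.instance Definition _ := [SubChoice_isSubLmodule of pullback by <:].

End Pullback.

(** Projectivity lifts along surjections, whereas here [d] need only reach the image of [h]. The
    projection of the pullback of [h] and [d] onto [Q] is surjective, so it has a section [s]; the
    other projection composed with [s] is the lift. *)
Lemma projective_lift (Q X Y : lmodType R) (h : {linear Q -> Y})
    (d : {linear X -> Y}) :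
    projective Q -> (forall q, exists x, d x = h q) ->
  exists k : {linear Q -> X}, forall q, d (k q) = h q.
Proof.
move=> projQ imh.
have fstL : linear (fun p : pullback h d => (val p).1) by [].
have sndL : linear (fun p : pullback h d => (val p).2) by [].
have idL : linear (fun q : Q => q) by [].
have [|s sE] := projQ _ _ (linear_pack fstL) (linear_pack idL).
  move=> q; have [x dx] := imh q.
  have qx : pullback_pred h d (q, x) by rewrite /pullback_pred /= dx.
  by exists (Pullback qx).
exists (linear_pack sndL \o s) => q /=.
have /eqP <- : pullback_pred h d (val (s q)) by case: (s q).
by congr (h _); exact: sE.
Qed.

Lemma projective_prod (P Q : lmodType R) :
  projective P -> projective Q -> projective (P * Q)%type.
Proof.
move=> projP projQ X Y f g fS.
have inlL : linear (fun p : P => g (p, 0)).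
  move=> a x y /=; rewrite -linearP; congr (g _).
  by apply: injective_projections; rewrite //= scaler0 addr0.
have inrL : linear (fun q : Q => g (0, q)).
  move=> a x y /=; rewrite -linearP; congr (g _).
  by apply: injective_projections; rewrite //= scaler0 addr0.
have [hP hPE] := projP _ _ f (linear_pack inlL) fS.
have [hQ hQE] := projQ _ _ f (linear_pack inrL) fS.
have hL : linear (fun p : P * Q => hP p.1 + hQ p.2).
  by move=> a x y /=; rewrite !linearP scalerDr addrACA.
exists (linear_pack hL) => -[p q] /=; rewrite linearD hPE hQE /= -linearD.
by congr (g _); apply: injective_projections; rewrite /= ?addr0 ?add0r.
Qed.

(** The pointwise condition inside [finitely_generated], isolated so that it can be treated as a
    submodule. *)
Definition in_span (V : lmodType R) (s : seq V) (x : V) : Prop :=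
  exists c : 'I_(size s) -> R, x = \sum_(i < size s) c i *: s`_i.

Lemma in_span_submodule (V : lmodType R) (s : seq V) : submodule (in_span s).
Proof.
split=> [|a _ _ [c ->] [c' ->]].
  by exists (fun=> 0); rewrite big1 // => i _; rewrite scale0r.
exists (fun i => a * c i + c' i); rewrite scaler_sumr -big_split /=.
by apply: eq_bigr => i _; rewrite scalerDl scalerA.
Qed.

Lemma in_span_mem (V : lmodType R) (s : seq V) x : x \in s -> in_span s x.
Proof.
move=> xs; have ltx : (index x s < size s)%N by rewrite index_mem.
exists (fun i => if i == Ordinal ltx then 1 else 0).
rewrite (bigD1 (Ordinal ltx)) //= eqxx scale1r nth_index // big1 ?addr0 //.
by move=> i /negPf ->; rewrite scale0r.
Qed.

Lemma in_span_min (V : lmodType R) (s : seq V) (P : V -> Prop) :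
    submodule P -> (forall x, x \in s -> P x) -> forall x, in_span s x -> P x.
Proof.
move=> subP Ps _ [c ->]; apply: big_ind => [|x y|i _].
- exact: submodule0.
- exact: submoduleD.
by apply: submoduleZ => //; apply/Ps/mem_nth.
Qed.

Lemma submodule_preim (U V : lmodType R) (f : {linear U -> V}) (P : V -> Prop) :
  submodule P -> submodule (fun x => P (f x)).
Proof.
by move=> [P0 PL]; split=> [|a x y]; rewrite ?linear0 // linearP; exact: PL.
Qed.

Lemma submodule_im (U V : lmodType R) (f : {linear U -> V}) :
  submodule (fun y => exists x, f x = y).
Proof.
split=> [|a _ _ [x <-] [y <-]]; first by exists 0; rewrite linear0.
by exists (a *: x + y); rewrite linearP.
Qed.

Lemma finitely_generated_prod (P Q : lmodType R) :
  finitely_generated P -> finitely_generated Q ->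
  finitely_generated (P * Q)%type.
Proof.
move=> [s sP] [s' s'P].
exists ([seq (x, 0) | x <- s] ++ [seq (0, y) | y <- s']) => -[p q].
set t := _ ++ _; change (in_span t (p, q)).
have inlL : linear (fun p : P => (p, 0 : Q)).
  by move=> a x y; apply: injective_projections; rewrite //= scaler0 addr0.
have inrL : linear (fun q : Q => (0 : P, q)).
  by move=> a x y; apply: injective_projections; rewrite //= scaler0 addr0.
have -> : (p, q) = (p, 0) + (0, q).
  by apply: injective_projections; rewrite /= ?addr0 ?add0r.
have subt := in_span_submodule t.
apply: submoduleD => //.
  apply: (in_span_min (submodule_preim (linear_pack inlL) subt) _ (sP p)) => x xs.
  by apply: in_span_mem; rewrite mem_cat map_f.
apply: (in_span_min (submodule_preim (linear_pack inrL) subt) _ (s'P q)) => x xs.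
by apply: in_span_mem; rewrite mem_cat orbC map_f.
Qed.

End Projective.

(** * The mapping cone of a short exact sequence *)

Section MappingCone.
Variables (R : pzRingType) (U W V : lmodType R).
Variables (delta : {linear U -> W}) (eps : {linear W -> V}).
Variables (Q : nat -> lmodType R) (dQ : forall i, {linear Q i.+1 -> Q i}).
Variable eQ : {linear Q 0%N -> U}.
Variables (P : nat -> lmodType R) (dP : forall i, {linear P i.+1 -> P i}).
Variable eP : {linear P 0%N -> W}.

Hypothesis delta_inj : forall u, delta u = 0 -> u = 0.
Hypothesis ex_W : exact_at delta eps.
Hypothesis eps_surj : surjective_map eps.
Hypothesis resQ : projective_resolution dQ eQ.
Hypothesis resP : projective_resolution dP eP.

Let dd (X : nat -> lmodType R) (d : forall i, {linear X i.+1 -> X i})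
    (ex : forall i, exact_at (d i.+1) (d i)) i x : d i (d i.+1 x) = 0.
Proof. by apply/ex; exists x. Qed.

(** The invariant of the recursion below: it is what [projective_lift] needs to produce the next
    comparison map. *)
Definition liftable i (f : {linear Q i -> P i}) : Prop :=
  forall q, exists p, dP i p = f (dQ i q).

(** The new map [g] covers [f \o dQ i], so [g \o dQ i.+1] is killed by [dP i] and exactness puts its
    values in the image of [dP i.+1]. The result is a sigma type because the recursion must extract
    the map as data. *)
Lemma comparison_step i (f : {linear Q i -> P i}) : liftable f ->
  {g : {linear Q i.+1 -> P i.+1} |
    liftable g /\ forall q, dP i (g q) = f (dQ i q)}.
Proof.
move=> fl; apply/cid.
have [projQ _ _ exQ] := resQ; have [_ _ _ exP] := resP.
have [g gE] := projective_lift (h := f \o dQ i) (projQ i.+1) fl.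
exists g; split=> // q; apply/exP; rewrite gE /= dd //.
by rewrite linear0.
Qed.

Lemma comparison_base :
  {f : {linear Q 0%N -> P 0%N} |
    liftable f /\ forall q, eP (f q) = delta (eQ q)}.
Proof.
apply/cid; have [projQ _ exQ0 _] := resQ; have [_ ePs exP0 _] := resP.
have [q|f fE] := projective_lift (h := delta \o eQ) (d := eP) (projQ 0%N).
  exact: ePs.
exists f; split=> // q; apply/exP0; rewrite fE /=.
by rewrite (proj2 (exQ0 _) _) ?linear0 //; exists q.
Qed.

(** Liftability travels with the map since each step consumes it; the commutation with differentials
    is read off afterwards from the same steps. *)
Fixpoint comparison_sig i : {f : {linear Q i -> P i} | liftable f} :=
  match i return {f : {linear Q i -> P i} | liftable f} with
  | 0%N => exist _ _ (svalP comparison_base).1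
  | j.+1 => exist _ _ (svalP (comparison_step (svalP (comparison_sig j)))).1
  end.

Definition comparison i : {linear Q i -> P i} := sval (comparison_sig i).

Lemma comparison0 q : eP (comparison 0%N q) = delta (eQ q).
Proof. exact: (svalP comparison_base).2. Qed.

Lemma comparisonS i q : dP i (comparison i.+1 q) = comparison i (dQ i q).
Proof. exact: (svalP (comparison_step (svalP (comparison_sig i)))).2. Qed.

Definition cone i : lmodType R :=
  if i is j.+1 then (P j.+1 * Q j)%type else P 0%N.

Lemma cone_d0_linear :
  linear (fun x : P 1%N * Q 0%N => dP 0%N x.1 + comparison 0%N x.2).
Proof. by move=> a x y /=; rewrite !linearP scalerDr addrACA. Qed.

(** The sign on [dQ] makes consecutive differentials compose to zero: the two comparison terms
    cancel by [comparisonS]. *)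
Lemma cone_dS_linear i :
  linear (fun x : P i.+2 * Q i.+1 =>
    (dP i.+1 x.1 + comparison i.+1 x.2, - dQ i x.2)).
Proof.
move=> a x y /=; apply: injective_projections => /=.
  by rewrite !linearP scalerDr addrACA.
by rewrite linearP opprD scalerN.
Qed.

Definition cone_d i : {linear cone i.+1 -> cone i} :=
  match i with
  | 0%N => linear_pack cone_d0_linear
  | j.+1 => linear_pack (@cone_dS_linear j)
  end.

Definition cone_aug : {linear cone 0%N -> V} := eps \o eP.

(** A direct diagram chase. In each positive degree a cycle [(p, q)] has [q] equal to a boundary
    [dQ q']; after correcting [p] by the comparison of [q'], exactness of [P] applies. *)
Lemma cone_resolution : projective_resolution cone_d cone_aug.
Proof.
have [projQ eQs exQ0 exQ] := resQ; have [projP ePs exP0 exP] := resP.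
have ePd p : eP (dP 0%N p) = 0 by apply/exP0; exists p.
have eQd q : eQ (dQ 0%N q) = 0 by apply/exQ0; exists q.
split.
- by case=> [|i]; [exact: projP|apply: projective_prod].
- by move=> v; have [w <-] := eps_surj v; have [p <-] := ePs w; exists p.
- move=> p; split=> [/ex_W [u]|[[p' q] <-]] /=.
    (* Since [eP p] lies in the image of [delta], subtracting the comparison of a preimage [q] moves
       [p] into the kernel of [eP]. *)
    have [q <-] := eQs u => /esym; rewrite -comparison0 => eq_ePp.
    have /exP0[p' p'E] : eP (p - comparison 0%N q) = 0.
      by rewrite linearB eq_ePp subrr.
    by exists (p', q) => /=; rewrite p'E subrK.
  rewrite linearD ePd add0r comparison0.
  by apply/ex_W; exists (eQ q).
case=> [|i] [p q]; split.
- move=> /= eq0.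
  (* In degree 1, applying [eP] to the cycle condition gives [delta (eQ q) = 0], and injectivity of
     [delta] concludes. *)
  have /exQ0[q' q'E] : eQ q = 0.
    apply: delta_inj; rewrite -comparison0 -[LHS]add0r -(ePd p) -linearD.
    by rewrite eq0 linear0.
  have /exP[p' p'E] : dP 0%N (p + comparison 1%N q') = 0.
    by rewrite linearD comparisonS q'E.
  (* The minus sign matches the one in the differential and also removes the correction that was
     added to [p]. *)
  exists (p', - q'); apply: injective_projections => /=.
    by rewrite p'E linearN addrK.
  by rewrite linearN opprK.
- move=> [[p' q'] [<- <-]] /=.
  by rewrite linearD dd // add0r comparisonS linearN addrN.
- move=> [/= eq0 /eqP]; rewrite oppr_eq0 => /eqP /exQ[q' q'E].
  have /exP[p' p'E] : dP i.+1 (p + comparison i.+2 q') = 0.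
    by rewrite linearD comparisonS q'E.
  exists (p', - q'); apply: injective_projections => /=.
    by rewrite p'E linearN addrK.
  by rewrite linearN opprK.
- move=> [[p' q'] [<- <-]] /=; apply: injective_projections => /=.
    by rewrite linearD dd // add0r comparisonS linearN addrN.
  by rewrite linearN dd // oppr0 oppr0.
Qed.

(** The strict bound on [Q] comes from the degree shift of the cone; it is why type FP for [A] is
    required one degree lower than for [M]. *)
Lemma cone_finitely_generated i :
    (forall j, (j <= i)%N -> finitely_generated (P j)) ->
    (forall j, (j < i)%N -> finitely_generated (Q j)) ->
  finitely_generated (cone i).
Proof.
case: i => [|i] fgP fgQ /=; first exact: fgP.
by apply: finitely_generated_prod; [exact: fgP|exact: fgQ].
Qed.

End MappingCone.

(** * Restriction and extension of scalars *)

(** A type alias, so that the [R]-structure obtained through [g] coexists with the [S]-structure of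
    [V]. *)
Definition restriction (R S : pzRingType) (g : {rmorphism R -> S})
  (V : lmodType S) : Type := V.

Section Restriction.
Variables (R S : pzRingType) (g : {rmorphism R -> S}).

Local Notation restriction := (restriction g).

Section Instances.
Variable V : lmodType S.

HB.instance Definition _ := GRing.Zmodule.on (restriction V).

Definition restriction_scale (r : R) (v : restriction V) : restriction V :=
  g r *: (v : V).

Lemma restriction_scaleA a b v :
  restriction_scale a (restriction_scale b v) = restriction_scale (a * b) v.
Proof. by rewrite /restriction_scale scalerA rmorphM. Qed.

Lemma restriction_scale1 : left_id 1 restriction_scale.
Proof. by move=> v; rewrite /restriction_scale rmorph1 scale1r. Qed.

Lemma restriction_scaleDr : right_distributive restriction_scale +%R.
Proof. by move=> r u v; rewrite /restriction_scale scalerDr. Qed.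

Lemma restriction_scaleDl v : {morph restriction_scale^~ v : a b / a + b}.
Proof. by move=> a b; rewrite /restriction_scale rmorphD scalerDl. Qed.

HB.instance Definition _ := GRing.Zmodule_isLmodule.Build R (restriction V)
  restriction_scaleA restriction_scale1 restriction_scaleDr restriction_scaleDl.

Lemma restrictionE r (v : restriction V) : r *: v = g r *: (v : V) :> V.
Proof. by []. Qed.

End Instances.

Lemma restriction_map_linear (V V' : lmodType S) (h : {linear V -> V'}) :
  linear (h : restriction V -> restriction V').
Proof. by move=> a x y; rewrite restrictionE [LHS]linearP. Qed.

Definition restriction_map (V V' : lmodType S) (h : {linear V -> V'}) :
  {linear restriction V -> restriction V'} :=
  linear_pack (restriction_map_linear h).

(* The second clause, that eta W generates E, stands for the uniqueness of k. *)
Definition is_extension (W : lmodType R) (E : lmodType S)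
    (eta : {linear W -> restriction E}) : Prop :=
  (forall (V : lmodType S) (h : {linear W -> restriction V}),
     exists k : {linear E -> V}, forall w, k (eta w) = h w) /\
  (forall P : E -> Prop, submodule P -> (forall w, P (eta w)) -> forall x, P x).

Section IsExtension.
Variables (W : lmodType R) (E : lmodType S) (eta : {linear W -> restriction E}).
Hypothesis extE : is_extension eta.

Lemma is_extension_ind (P : E -> Prop) :
  submodule P -> (forall w, P (eta w)) -> forall x, P x.
Proof. by case: extE => _; apply. Qed.

Lemma is_extension_eq (V : lmodType S) (h k : {linear E -> V}) :
  (forall w, h (eta w) = k (eta w)) -> h =1 k.
Proof.
apply: is_extension_ind; split=> [|a x y hx hy]; first by rewrite !linear0.
by rewrite !linearP hx hy.
Qed.

(** Extension is left adjoint to restriction, which preserves surjections: lift over [R], extend to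
    [E], and compare on the image of [eta]. *)
Lemma is_extension_projective : projective W -> projective E.
Proof.
move=> projW X Y f h fS; have [ext _] := extE.
have [k kE] := projW _ _ (restriction_map f) (restriction_map h \o eta) fS.
have [l lE] := ext _ k; exists l.
by apply: (@is_extension_eq _ (f \o l) h) => w /=; rewrite lE; exact: kE.
Qed.

(** The images of generators of [W] suffice: the preimage under [eta] of their [S]-span is an
    [R]-submodule containing those generators, hence all of [W]. *)
Lemma is_extension_finitely_generated :
  finitely_generated W -> finitely_generated E.
Proof.
move=> [s sW]; exists (map eta s); apply: is_extension_ind => [|w].
  exact: in_span_submodule.
have [P0 PL] := in_span_submodule (map eta s : seq E).
have subP : submodule (fun x => in_span (map eta s : seq E) (eta x)).
  by split=> [|a x y Px Py]; rewrite ?linear0 // linearP; exact: PL.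
by apply: (in_span_min subP _ (sW w)) => x xs; apply/in_span_mem/map_f.
Qed.

End IsExtension.
End Restriction.

(** * Tensor induction along a ring homomorphism *)

Section Induced.
Variables (B R : pzRingType) (i : {rmorphism B -> R}).

Local Notation X := (right_module_along i).

Lemma tensor_ind (B' : pzRingType) (X' : lmodType B'^c) (Y : lmodType B')
    (P : tensor X' Y -> Prop) :
    P 0 -> (forall u v, P u -> P v -> P (u - v)) -> (forall x y, P (pure x y)) ->
  forall u, P u.
Proof.
move=> P0 PB Pp u; rewrite -[u]tensor_pi_repr.
elim/malg_zmod_ind: (repr u) => [|v w Pv Pw|[x y]].
- by rewrite raddf0.
- by rewrite raddfB; exact: PB.
- exact: Pp.
Qed.

Section Def.
Variable Y : lmodType B.

Definition induced : Type := tensor X Y.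

HB.instance Definition _ := GRing.Zmodule.on induced.

Definition induced_scale (r : R) (u : induced) : induced :=
  tensor_lift (fun (x : X) y => pure (r * x : X) y) u.

(** Left multiplication on [R] commutes with the right [B]-action, so it descends to the tensor
    product; these are the three conditions asked by [tensor_lift]. *)
Let scale_compat r :
  [/\ forall (x x' : X) y, pure (r * (x + x') : X) y
        = pure (r * x : X) y + pure (r * x' : X) y :> tensor X Y,
      forall (x : X) y y', pure (r * x : X) (y + y')
        = pure (r * x : X) y + pure (r * x : X) y' :> tensor X Y &
      forall (x : X) (b : B) y, pure (r * ((b : B^c) *: x) : X) y
        = pure (r * x : X) (b *: y) :> tensor X Y].
Proof.
split=> [x x' y|x y y'|x b y]; first by rewrite mulrDr pureDl.
  exact: pureDr.
by rewrite -pure_balanced; congr pure; exact: mulrA.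
Qed.

Lemma induced_scale_pure r (x : X) y :
  induced_scale r (pure x y) = pure (r * x : X) y.
Proof. by have [? ? ?] := scale_compat r; exact: tensor_lift_pure. Qed.

Lemma induced_scaleB r u v :
  induced_scale r (u - v) = induced_scale r u - induced_scale r v.
Proof. by have [? ? ?] := scale_compat r; exact: tensor_lift_zmod_morphism. Qed.

Lemma induced_scale0 r : induced_scale r 0 = 0.
Proof. by rewrite -{1}(subrr 0) induced_scaleB subrr. Qed.

Lemma induced_scaleA a b u :
  induced_scale a (induced_scale b u) = induced_scale (a * b) u.
Proof.
elim/tensor_ind: u => [|u v Hu Hv|x y]; first by rewrite !induced_scale0.
  by rewrite !induced_scaleB Hu Hv.
by rewrite !induced_scale_pure mulrA.
Qed.

Lemma induced_scale1 : left_id 1 induced_scale.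
Proof.
elim/tensor_ind=> [|u v Hu Hv|x y]; first by rewrite !induced_scale0.
  by rewrite !induced_scaleB Hu Hv.
by rewrite !induced_scale_pure mul1r.
Qed.

Lemma induced_scaleDr : right_distributive induced_scale +%R.
Proof.
move=> r u v; rewrite -{1}[v]opprK induced_scaleB -[- v]sub0r induced_scaleB.
by rewrite induced_scale0 sub0r opprK.
Qed.

Lemma induced_scaleDl u : {morph induced_scale^~ u : a b / a + b}.
Proof.
move=> a b; elim/tensor_ind: u => [|u v Hu Hv|x y].
- by rewrite !induced_scale0 addr0.
- by rewrite !induced_scaleB Hu Hv opprD addrACA.
by rewrite !induced_scale_pure mulrDl pureDl.
Qed.

HB.instance Definition _ := GRing.Zmodule_isLmodule.Build R induced
  induced_scaleA induced_scale1 induced_scaleDr induced_scaleDl.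

Definition induced_pure (r : R) (y : Y) : induced := pure (r : X) y.

Lemma induced_pureE r y : induced_pure r y = r *: induced_pure 1 y.
Proof. by rewrite [RHS]induced_scale_pure mulr1. Qed.

Lemma induced_unit_linear :
  linear (induced_pure 1 : Y -> restriction i induced).
Proof.
move=> b y y'; rewrite [LHS]pureDr; congr (_ + _).
rewrite -pure_balanced restrictionE -induced_pureE; congr pure.
by rewrite /GRing.scale /= /along_scale mul1r.
Qed.

Definition induced_unit : {linear Y -> restriction i induced} :=
  linear_pack induced_unit_linear.

Lemma induced_ind (P : induced -> Prop) :
  submodule P -> (forall y, P (induced_unit y)) -> forall u, P u.
Proof.
move=> subP Pu; elim/tensor_ind => [|u v Hu Hv|x y].
- exact: (submodule0 subP).
- exact: (submoduleB subP).
rewrite -[pure x y]/(induced_pure x y) induced_pureE.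
exact/(submoduleZ subP)/Pu.
Qed.

Section Lift.
Variables (V : lmodType R) (h : {linear Y -> restriction i V}).

Definition induced_lift_fun (u : induced) : V :=
  tensor_lift (fun (x : X) y => (x : R) *: (h y : V)) u.

Let lift_compat :
  [/\ forall (x x' : X) y,
        ((x + x' : X) : R) *: (h y : V)
          = (x : R) *: (h y : V) + (x' : R) *: (h y : V),
      forall (x : X) y y',
        (x : R) *: (h (y + y') : V)
          = (x : R) *: (h y : V) + (x : R) *: (h y' : V) &
      forall (x : X) (b : B) y, (((b : B^c) *: x : X) : R) *: (h y : V)
        = (x : R) *: (h (b *: y) : V)].
Proof.
split=> [x x' y|x y y'|x b y].
- by rewrite -scalerDl.
- by rewrite -scalerDr linearD.
by rewrite linearZ /= restrictionE scalerA.
Qed.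

Lemma induced_lift_fun_pure r y :
  induced_lift_fun (induced_pure r y) = r *: (h y : V).
Proof. by have [? ? ?] := lift_compat; exact: tensor_lift_pure. Qed.

Lemma induced_lift_linear : linear induced_lift_fun.
Proof.
have [? ? ?] := lift_compat.
have FB u v : induced_lift_fun (u - v) = induced_lift_fun u - induced_lift_fun v.
  exact: tensor_lift_zmod_morphism.
have F0 : induced_lift_fun 0 = 0 by rewrite -{1}(subrr 0) FB subrr.
have FD u v : induced_lift_fun (u + v) = induced_lift_fun u + induced_lift_fun v.
  by rewrite -{1}[v]opprK FB -sub0r FB F0 sub0r opprK.
move=> r u v; rewrite FD; congr (_ + _).
elim/tensor_ind: u => [|u w Hu Hw|x y].
- by rewrite [X in induced_lift_fun X]scaler0 F0 scaler0.
- by rewrite scalerBr !FB Hu Hw scalerBr.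
rewrite -[pure x y]/(induced_pure x y) [r *: _]induced_scale_pure.
by rewrite -[pure _ y]/(induced_pure (r * x) y) !induced_lift_fun_pure scalerA.
Qed.

Definition induced_lift : {linear induced -> V} :=
  linear_pack induced_lift_linear.

Lemma induced_lift_unit y : induced_lift (induced_unit y) = h y.
Proof. by rewrite /= induced_lift_fun_pure scale1r. Qed.

End Lift.

Lemma induced_extension : is_extension induced_unit.
Proof.
split; last exact: induced_ind.
by move=> V h; exists (induced_lift h); exact: induced_lift_unit.
Qed.

Lemma induced_eq (V : lmodType R) (h k : {linear induced -> V}) :
  (forall y, h (induced_unit y) = k (induced_unit y)) -> h =1 k.
Proof. exact: (is_extension_eq induced_extension). Qed.

End Def.

Section Map.
Variables (Y Y' : lmodType B) (g : {linear Y -> Y'}).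

Lemma induced_map_linear : linear (tensor_map X g : induced Y -> induced Y').
Proof.
have F0 : tensor_map X g 0 = 0 by exact: raddf0.
have FB u v : tensor_map X g (u - v) = tensor_map X g u - tensor_map X g v.
  exact: raddfB.
move=> r u v; rewrite [LHS]raddfD; congr (_ + _).
elim/tensor_ind: u => [|u w Hu Hw|x y].
- by rewrite [r *: 0 in LHS]scaler0 F0 [RHS]scaler0.
- by rewrite scalerBr [LHS]FB Hu Hw FB scalerBr.
rewrite [r *: _]induced_scale_pure [LHS]tensor_map_pure tensor_map_pure.
by rewrite [RHS]induced_scale_pure.
Qed.

Definition induced_map : {linear induced Y -> induced Y'} :=
  linear_pack induced_map_linear.

Lemma induced_map_unit y : induced_map (induced_unit Y y) = induced_unit Y' (g y).
Proof. exact: tensor_map_pure. Qed.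

End Map.

Lemma induced_map_comp (Y Y' Y'' : lmodType B) (g : {linear Y -> Y'})
    (g' : {linear Y' -> Y''}) u :
  induced_map g' (induced_map g u) = induced_map (g' \o g) u.
Proof.
move: u; apply: (@induced_eq _ _ (induced_map g' \o induced_map g)) => y.
by rewrite -[LHS]/(induced_map g' (induced_map g _)) !induced_map_unit.
Qed.

Lemma induced_map_id (Y : lmodType B) (g : {linear Y -> Y}) :
  g =1 id -> induced_map g =1 id.
Proof.
move=> g1; apply: (@induced_eq _ _ _ idfun) => y.
by rewrite induced_map_unit g1.
Qed.

Lemma induced_map_surjective (Y Y' : lmodType B) (g : {linear Y -> Y'}) :
  surjective_map g -> surjective_map (induced_map g).
Proof.
move=> gS; apply: induced_ind; first exact: submodule_im.
move=> y; have [x <-] := gS y.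
by exists (induced_unit Y x); rewrite induced_map_unit.
Qed.

(** The underlying function of [induced_map] is [tensor_map], and exactness concerns underlying
    functions only, so flatness applies verbatim. *)
Lemma induced_map_exact (Y1 Y2 Y3 : lmodType B) (g : {linear Y1 -> Y2})
    (g' : {linear Y2 -> Y3}) :
  flat X -> exact_at g g' -> exact_at (induced_map g) (induced_map g').
Proof. by move=> flatX exg; exact: flatX. Qed.

End Induced.

(** * The tensor algebra of a twisted bimodule *)

Section DirectSum.
Variable R : pzRingType.

Section Def.
Variable X : nat -> lmodType R.

Record direct_sum : Type := DirectSum {
  component : forall k, X k;
  component_finite : exists n, forall k, (n <= k)%N -> component k = 0
}.

HB.instance Definition _ := gen_eqMixin direct_sum.
HB.instance Definition _ := gen_choiceMixin direct_sum.

Lemma direct_sumP (x y : direct_sum) :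
  (forall k, component x k = component y k) -> x = y.
Proof.
case: x y => [x xf] [y yf] /= eq_xy.
have {}eq_xy : x = y by exact: functional_extensionality_dep.
by case: y / eq_xy yf => yf; congr DirectSum; exact: Prop_irrelevance.
Qed.

Program Definition direct_sum0 : direct_sum := @DirectSum (fun=> 0) _.
Next Obligation. by exists 0%N. Qed.

(** Addition, scaling and opposite are all instances of this one combination, so finiteness of
    support is proved once. *)
Program Definition direct_sumL (a : R) (x y : direct_sum) : direct_sum :=
  @DirectSum (fun k => a *: component x k + component y k) _.
Next Obligation.
have [n xn] := component_finite x; have [m ym] := component_finite y.
exists (maxn n m) => k; rewrite geq_max => /andP[nk mk].
by rewrite xn // ym // scaler0 addr0.
Qed.

Definition direct_sum_add x y := direct_sumL 1 x y.
Definition direct_sum_scale a x := direct_sumL a x direct_sum0.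
Definition direct_sum_opp x := direct_sum_scale (-1) x.

Lemma direct_sum_addE x y k :
  component (direct_sum_add x y) k = component x k + component y k.
Proof. by rewrite /= scale1r. Qed.

Lemma direct_sum_scaleE a x k :
  component (direct_sum_scale a x) k = a *: component x k.
Proof. by rewrite /= addr0. Qed.

Lemma direct_sum_oppE x k : component (direct_sum_opp x) k = - component x k.
Proof. by rewrite direct_sum_scaleE scaleN1r. Qed.

Lemma direct_sum_addA : associative direct_sum_add.
Proof. by move=> x y z; apply: direct_sumP => k; rewrite !direct_sum_addE addrA. Qed.

Lemma direct_sum_addC : commutative direct_sum_add.
Proof. by move=> x y; apply: direct_sumP => k; rewrite !direct_sum_addE addrC. Qed.

Lemma direct_sum_add0 : left_id direct_sum0 direct_sum_add.
Proof. by move=> x; apply: direct_sumP => k; rewrite direct_sum_addE add0r. Qed.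

Lemma direct_sum_addN : left_inverse direct_sum0 direct_sum_opp direct_sum_add.
Proof.
move=> x; apply: direct_sumP => k.
by rewrite direct_sum_addE direct_sum_oppE addNr.
Qed.

HB.instance Definition _ := GRing.isZmodule.Build direct_sum
  direct_sum_addA direct_sum_addC direct_sum_add0 direct_sum_addN.

Lemma direct_sum_scaleA a b x :
  direct_sum_scale a (direct_sum_scale b x) = direct_sum_scale (a * b) x.
Proof. by apply: direct_sumP => k; rewrite !direct_sum_scaleE scalerA. Qed.

Lemma direct_sum_scale1 : left_id 1 direct_sum_scale.
Proof. by move=> x; apply: direct_sumP => k; rewrite direct_sum_scaleE scale1r. Qed.

Lemma direct_sum_scaleDr : right_distributive direct_sum_scale +%R.
Proof.
move=> r x y; apply: direct_sumP => k.
by rewrite direct_sum_scaleE !direct_sum_addE !direct_sum_scaleE scalerDr.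
Qed.

Lemma direct_sum_scaleDl x : {morph direct_sum_scale^~ x : a b / a + b}.
Proof.
move=> a b; apply: direct_sumP => k.
by rewrite direct_sum_addE !direct_sum_scaleE scalerDl.
Qed.

HB.instance Definition _ := GRing.Zmodule_isLmodule.Build R direct_sum
  direct_sum_scaleA direct_sum_scale1 direct_sum_scaleDr direct_sum_scaleDl.

Lemma component_linear k : linear (fun x : direct_sum => component x k).
Proof. by move=> a x y; rewrite direct_sum_addE direct_sum_scaleE. Qed.

Definition proj k : {linear direct_sum -> X k} :=
  linear_pack (@component_linear k).

Lemma projP (x y : direct_sum) : (forall k, proj k x = proj k y) -> x = y.
Proof. exact: direct_sumP. Qed.

Lemma proj_finite (x : direct_sum) : exists n, forall k, (n <= k)%N -> proj k x = 0.
Proof. exact: component_finite. Qed.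

Program Definition head_sum (v : X 0%N) : direct_sum :=
  @DirectSum (fun k => if k is 0 then v else 0) _.
Next Obligation. by exists 1%N; case. Qed.

Lemma head_sum_linear : linear head_sum.
Proof.
move=> a x y; apply: projP => k; rewrite [RHS]linearP /=.
by case: k => [|k] //=; rewrite scaler0 addr0.
Qed.

Definition head_inj : {linear X 0%N -> direct_sum} := linear_pack head_sum_linear.

Lemma proj_head0 v : proj 0%N (head_inj v) = v. Proof. by []. Qed.
Lemma proj_headS v k : proj k.+1 (head_inj v) = 0. Proof. by []. Qed.

End Def.

Arguments proj {X} k.

Section Map.
Variables X Y : nat -> lmodType R.
Variable g : forall k, {linear X k -> Y k}.

Program Definition direct_sum_map_fun (x : direct_sum X) : direct_sum Y :=
  @DirectSum _ (fun k => g k (component x k)) _.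
Next Obligation.
have [n xn] := component_finite x; exists n => k nk.
by rewrite xn // linear0.
Qed.

Lemma direct_sum_map_linear : linear direct_sum_map_fun.
Proof.
move=> a x y; apply: projP => k; rewrite [RHS]linearP.
exact: (linearP (g k \o proj k)).
Qed.

Definition direct_sum_map : {linear direct_sum X -> direct_sum Y} :=
  linear_pack direct_sum_map_linear.

Lemma proj_map k x : proj k (direct_sum_map x) = g k (proj k x).
Proof. by []. Qed.

End Map.

Lemma direct_sum_map_exact (X Y Z : nat -> lmodType R)
    (g : forall k, {linear X k -> Y k}) (h : forall k, {linear Y k -> Z k}) :
    (forall k, exact_at (g k) (h k)) ->
  exact_at (direct_sum_map g) (direct_sum_map h).
Proof.
move=> exgh y; split=> [hy0|[x <-]]; last first.
  apply: projP => k; rewrite !proj_map linear0.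
  by apply/exgh; exists (proj k x).
(* Taking the preimage 0 wherever the component of [y] is 0 keeps the chosen family finitely
   supported. *)
have pre k : exists x, g k x = proj k y /\ (proj k y = 0 -> x = 0).
  have [yk0|yk0] := pselect (proj k y = 0).
    by exists 0; rewrite linear0.
  have /exgh[x gx] : h k (proj k y) = 0 by rewrite -proj_map hy0 linear0.
  by exists x.
pose x k := sval (cid (pre k)).
have xE k : g k (x k) = proj k y by case: (svalP (cid (pre k))).
have xf : exists n, forall k, (n <= k)%N -> x k = 0.
  have [n yn] := proj_finite y; exists n => k /yn.
  by case: (svalP (cid (pre k))).
by exists (DirectSum xf); apply: projP.
Qed.

End DirectSum.

Arguments proj {R X} k.

(** * The functors T and F on [R]-modules *)

Section TensorAlgebra.
Variables (B R : pzRingType) (i f : {rmorphism B -> R}).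

Definition twist (W : lmodType R) : lmodType R := induced i (restriction f W).

Definition twist_unit (W : lmodType R) :
    {linear restriction f W -> restriction i (twist W)} :=
  induced_unit i (restriction f W).

Definition twist_pure (W : lmodType R) (w : W) : twist W := twist_unit W w.

(** With [twist_pure w], that is 1 (x) w, read as t w, this is the relation a t = t phi(a). *)
Lemma twist_pureZ (W : lmodType R) b (w : W) :
  twist_pure (f b *: w) = i b *: twist_pure w.
Proof. exact: (linearZ_LR (twist_unit W)). Qed.

Lemma twist_pureD (W : lmodType R) : {morph @twist_pure W : u v / u + v}.
Proof. exact: (linearD (twist_unit W)). Qed.

Lemma twist_pureN (W : lmodType R) : {morph @twist_pure W : u / - u}.
Proof. exact: (linearN (twist_unit W)). Qed.

Lemma twist_pureB (W : lmodType R) : {morph @twist_pure W : u v / u - v}.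
Proof. exact: (linearB (twist_unit W)). Qed.

Lemma twist_pure0 (W : lmodType R) : twist_pure (0 : W) = 0.
Proof. exact: (linear0 (twist_unit W)). Qed.

Lemma twist_ind (W : lmodType R) (P : twist W -> Prop) :
  submodule P -> (forall w, P (twist_pure w)) -> forall u, P u.
Proof. exact: (@induced_ind _ _ i (restriction f W)). Qed.

Lemma twist_eq (W V : lmodType R) (h k : {linear twist W -> V}) :
  (forall w, h (twist_pure w) = k (twist_pure w)) -> h =1 k.
Proof. exact: (@induced_eq _ _ i (restriction f W)). Qed.

Definition twist_map (W W' : lmodType R) (g : {linear W -> W'}) :
  {linear twist W -> twist W'} := induced_map i (restriction_map f g).

Lemma twist_map_pure (W W' : lmodType R) (g : {linear W -> W'}) w :
  twist_map g (twist_pure w) = twist_pure (g w).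
Proof. exact: induced_map_unit. Qed.

Lemma twist_mapK (W W' : lmodType R) (g : {linear W -> W'})
    (g' : {linear W' -> W}) :
  cancel g g' -> cancel (twist_map g) (twist_map g').
Proof.
move=> gK u; rewrite [LHS]induced_map_comp.
by apply: induced_map_id => w; exact: gK.
Qed.

Lemma twist_map_exact (W1 W2 W3 : lmodType R) (g : {linear W1 -> W2})
    (g' : {linear W2 -> W3}) :
    flat (right_module_along i) ->
  exact_at g g' -> exact_at (twist_map g) (twist_map g').
Proof. by move=> flati exg; apply: induced_map_exact. Qed.

Fixpoint tower (W : lmodType R) k : lmodType R :=
  if k is j.+1 then twist (tower W j) else W.

Fixpoint tower_map (W W' : lmodType R) (g : {linear W -> W'}) k :
    {linear tower W k -> tower W' k} :=
  if k is j.+1 then twist_map (tower_map g j) else g.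

Lemma tower_map_exact (W1 W2 W3 : lmodType R) (g : {linear W1 -> W2})
    (g' : {linear W2 -> W3}) k :
    flat (right_module_along i) ->
  exact_at g g' -> exact_at (tower_map g k) (tower_map g' k).
Proof.
by move=> flati exg; elim: k => //= k IHk; exact: twist_map_exact.
Qed.

(* tower peels off T on the outside, so T^k (T W) and T (T^k W) are only
   isomorphic. *)
Fixpoint tower_shift (W : lmodType R) k :
    {linear tower (twist W) k -> twist (tower W k)} :=
  if k is j.+1 then twist_map (tower_shift W j) else idfun.

Fixpoint tower_unshift (W : lmodType R) k :
    {linear twist (tower W k) -> tower (twist W) k} :=
  if k is j.+1 then twist_map (tower_unshift W j) else idfun.

(** Needed for the injectivity of [tower_shift], on which that of [tensor_delta] rests. *)
Lemma tower_shiftK (W : lmodType R) k :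
  cancel (tower_shift W k) (tower_unshift W k).
Proof. by elim: k => //= k IHk; exact: twist_mapK. Qed.

Definition tensor_module (W : lmodType R) : lmodType R := direct_sum (tower W).

Definition tensor_unit (W : lmodType R) : {linear W -> tensor_module W} :=
  head_inj (tower W).

Definition tensor_module_map (W W' : lmodType R) (g : {linear W -> W'}) :
  {linear tensor_module W -> tensor_module W'} := direct_sum_map (tower_map g).

Section Shift.
Variable W : lmodType R.

(** The action of t on F W, raising the degree by one. Its linearity from [restriction f] to
    [restriction i] again encodes a t = t phi(a). *)
Program Definition tensor_shift_fun (x : tensor_module W) : tensor_module W :=
  @DirectSum _ _ (fun k => if k is j.+1 then twist_pure (component x j) else 0) _.
Next Obligation.
have [n xn] := component_finite x; exists n.+1 => -[|k] // nk.
by rewrite xn // twist_pure0.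
Qed.

Lemma tensor_shift_linear : linear
  (tensor_shift_fun : restriction f (tensor_module W) ->
                      restriction i (tensor_module W)).
Proof.
move=> b x y; apply: projP => k.
rewrite [RHS](linearP (proj k) (i b) (tensor_shift_fun x) (tensor_shift_fun y)).
case: k => [|k]; first by rewrite /= scaler0 addr0.
transitivity (twist_pure (f b *: proj k x + proj k y)); last first.
  by rewrite twist_pureD twist_pureZ.
by congr (twist_pure _); exact: (linearP (proj k) (f b) x y).
Qed.

Definition tensor_shift :
    {linear restriction f (tensor_module W) -> restriction i (tensor_module W)} :=
  linear_pack tensor_shift_linear.

Lemma proj_shift0 x : proj 0%N (tensor_shift x) = 0.
Proof. by []. Qed.

Lemma proj_shiftS x k :
  proj k.+1 (tensor_shift x) = twist_pure (proj k x).
Proof. by []. Qed.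

End Shift.
End TensorAlgebra.

Section TensorModuleLift.
Variables (B R : pzRingType) (i f : {rmorphism B -> R}).

Local Notation tower := (tower i f).
Local Notation twist := (twist i f).
Local Notation twist_pure := (twist_pure i f).
Local Notation tensor_module := (tensor_module i f).
Local Notation tensor_unit := (tensor_unit i f).
Local Notation tensor_shift := (tensor_shift i f).

Section Lift.
Variables (W V : lmodType R) (g : {linear W -> V}).
Variable tau : {linear restriction f V -> restriction i V}.

(** On 1 (x) ... (x) 1 (x) w this is the [k]-fold iterate of [tau] applied to [g w]. *)
Fixpoint tower_lift k : {linear tower W k -> V} :=
  if k is j.+1 then induced_lift (tau \o restriction_map f (tower_lift j)) else g.

Lemma tower_lift_pure k u :
  tower_lift k.+1 (twist_pure u) = tau (tower_lift k u).
Proof. exact: (induced_lift_unit (tau \o restriction_map f (tower_lift k))). Qed.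

Definition tensor_module_lift_fun (x : tensor_module W) : V :=
  \sum_(0 <= k < sval (cid (proj_finite x))) tower_lift k (proj k x).

(** The defining sum uses a bound picked by choice; terms beyond any valid bound vanish, so every
    bound gives the same value and different elements can share one. *)
Lemma tensor_module_lift_bound n (x : tensor_module W) :
    (forall k, (n <= k)%N -> proj k x = 0) ->
  tensor_module_lift_fun x = \sum_(0 <= k < n) tower_lift k (proj k x).
Proof.
have sum_ge m p : (m <= p)%N -> (forall k, (m <= k)%N -> proj k x = 0) ->
    \sum_(0 <= k < p) tower_lift k (proj k x)
      = \sum_(0 <= k < m) tower_lift k (proj k x).
  move=> mp xm; rewrite (big_cat_nat (n := m)) // -[RHS]addr0; congr (_ + _).
  rewrite big_nat_cond big1 // => k /andP[/andP[mk _] _].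
  by rewrite xm // linear0.
rewrite /tensor_module_lift_fun; case: cid => m /= xm xn.
have [mn|/ltnW nm] := leqP m n; first by rewrite (sum_ge _ _ mn).
by rewrite -(sum_ge _ _ nm).
Qed.

Lemma tensor_module_lift_linear : linear tensor_module_lift_fun.
Proof.
move=> a x y; have [n xn] := proj_finite x; have [m ym] := proj_finite y.
have le_x k : (maxn n m <= k)%N -> proj k x = 0.
  by rewrite geq_max => /andP[nk _]; exact: xn.
have le_y k : (maxn n m <= k)%N -> proj k y = 0.
  by rewrite geq_max => /andP[_ mk]; exact: ym.
rewrite (@tensor_module_lift_bound (maxn n m)); last first.
  by move=> k mk; rewrite linearP le_x // le_y // scaler0 addr0.
rewrite !(@tensor_module_lift_bound (maxn n m)) // scaler_sumr -big_split.
by apply: eq_bigr => k _; exact: (linearP (tower_lift k \o proj k)).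
Qed.

Definition tensor_module_lift : {linear tensor_module W -> V} :=
  linear_pack tensor_module_lift_linear.

Lemma tensor_module_lift_tensor_unit w :
  tensor_module_lift (tensor_unit W w) = g w.
Proof.
rewrite -[LHS]/(tensor_module_lift_fun _) (@tensor_module_lift_bound 1%N).
  by rewrite big_nat1.
by case.
Qed.

Lemma tensor_module_lift_shift x :
  tensor_module_lift (tensor_shift W x) = tau (tensor_module_lift x).
Proof.
have [n xn] := proj_finite x.
(* The shift turns the bound [n] into [n.+1] and has zero component in degree 0, so the sum
   reindexes. *)
rewrite -[LHS]/(tensor_module_lift_fun _) (@tensor_module_lift_bound n.+1).
  rewrite big_nat_recl // proj_shift0 linear0 add0r.
  rewrite -[X in tau X]/(tensor_module_lift_fun _) (@tensor_module_lift_bound n) //.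
  rewrite [RHS](raddf_sum tau); apply: eq_bigr => k _.
  by rewrite proj_shiftS tower_lift_pure.
by case=> // k nk; rewrite proj_shiftS xn //; exact: twist_pure0.
Qed.

End Lift.

Section Generation.
Variable W : lmodType R.

(** Building the inclusion of degree [k] by iterating the shift on degree 0 avoids transport along
    equalities of degrees. *)
Definition tower_inj k : {linear tower W k -> tensor_module W} :=
  tower_lift (tensor_unit W) (tensor_shift W) k.

Lemma proj_tower_inj k u : proj k (tower_inj k u) = u.
Proof.
elim: k u => [|k IHk] // u.
move: u; apply: (twist_eq (h := proj k.+1 \o tower_inj k.+1) (k := idfun)) => u.
rewrite -[LHS]/(proj k.+1 (tower_inj k.+1 (twist_pure u))).
by rewrite tower_lift_pure proj_shiftS IHk.
Qed.

Lemma proj_tower_inj_neq k m u : m != k -> proj m (tower_inj k u) = 0.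
Proof.
elim: k m u => [|k IHk] [|m] // u mk.
  move: u; apply: (twist_eq (h := proj 0%N \o tower_inj k.+1) (k := \0)) => u.
  rewrite -[LHS]/(proj 0%N (tower_inj k.+1 (twist_pure u))).
  by rewrite tower_lift_pure.
move: u; apply: (twist_eq (h := proj m.+1 \o tower_inj k.+1) (k := \0)) => u.
rewrite -[LHS]/(proj m.+1 (tower_inj k.+1 (twist_pure u))).
rewrite tower_lift_pure proj_shiftS IHk //.
exact: twist_pure0.
Qed.

(** F W is generated by W under [R] and t: an element is the sum of its components, and T^(k+1) W is
    spanned by the [twist_pure u], whose inclusions are shifts from degree [k]. *)
Lemma tensor_module_ind (P : tensor_module W -> Prop) :
    submodule P -> (forall w, P (tensor_unit W w)) ->
    (forall x, P x -> P (tensor_shift W x)) ->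
  forall x, P x.
Proof.
move=> subP Pu Ps x; have [n xn] := proj_finite x.
have -> : x = \sum_(0 <= k < n) tower_inj k (proj k x).
  apply: projP => k; rewrite (linear_sum (proj k)).
  have [nk|kn] := leqP n k.
    rewrite xn // big_nat_cond big1 // => m /andP[/andP[_ mn] _].
    by apply: proj_tower_inj_neq; rewrite gtn_eqF // (leq_trans mn).
  rewrite (bigD1_seq k) ?mem_index_iota ?iota_uniq //.
  rewrite -[LHS]addr0; congr (_ + _); first by rewrite proj_tower_inj.
  rewrite big1 // => m mk.
  by apply: proj_tower_inj_neq; rewrite eq_sym.
apply: big_ind => [|y z|k _]; [exact: submodule0|exact: submoduleD|].
elim: k (proj k x) => [|k IHk] u; first exact: Pu.
move: u; apply: (twist_ind (submodule_preim (tower_inj k.+1) subP)) => u.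
by rewrite -[X in P X]/(tower_inj k.+1 (twist_pure u)) tower_lift_pure; exact: Ps.
Qed.

End Generation.

Lemma tensor_module_map_unit (W W' : lmodType R) (g : {linear W -> W'}) w :
  tensor_module_map i f g (tensor_unit W w) = tensor_unit W' (g w).
Proof. by apply: projP => -[|k] //; rewrite proj_map proj_headS linear0. Qed.

Lemma tensor_module_map_shift (W W' : lmodType R) (g : {linear W -> W'}) x :
  tensor_module_map i f g (tensor_shift W x)
    = tensor_shift W' (tensor_module_map i f g x).
Proof.
apply: projP => -[|k]; rewrite proj_map ?proj_shift0 ?linear0 //.
by rewrite !proj_shiftS proj_map [LHS]twist_map_pure.
Qed.

Lemma tensor_module_map_exact (W1 W2 W3 : lmodType R) (g : {linear W1 -> W2})
    (g' : {linear W2 -> W3}) :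
    flat (right_module_along i) -> exact_at g g' ->
  exact_at (tensor_module_map i f g) (tensor_module_map i f g').
Proof.
by move=> flati exg; apply: direct_sum_map_exact => k; exact: tower_map_exact.
Qed.

Lemma tensor_module_map_surjective (W W' : lmodType R) (g : {linear W -> W'}) :
  surjective_map g -> surjective_map (tensor_module_map i f g).
Proof.
move=> gS; apply: tensor_module_ind => [|w|_ [x <-]]; first exact: submodule_im.
  have [v <-] := gS w; exists (tensor_unit W v); exact: tensor_module_map_unit.
by exists (tensor_shift W x); exact: tensor_module_map_shift.
Qed.

(** * The short exact sequence 0 -> F (T V) -> F V -> V -> 0 *)

Section Sequence.
Variables (V : lmodType R) (tau : {linear restriction f V -> restriction i V}).

Definition action_map : {linear twist V -> V} := induced_lift tau.

Lemma action_map_pure v : action_map (twist_pure v) = tau v.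
Proof. exact: induced_lift_unit. Qed.

Definition tensor_counit : {linear tensor_module V -> V} :=
  tensor_module_lift idfun tau.

(* An element x of T^k (T V) is sent to x, placed in degree k + 1, minus its
   image under T^k of the action T V -> V, placed in degree k. *)
Program Definition tensor_delta_fun (x : tensor_module (twist V)) :
    tensor_module V :=
  @DirectSum _ (tower V) (fun k =>
    (if k is j.+1 return tower V k then tower_shift i f V j (component x j) else 0)
      - tower_map i f action_map k (component x k)) _.
Next Obligation.
have [n xn] := component_finite x; exists n.+1 => -[|k] // nk.
rewrite (xn k) // (xn k.+1) 1?ltnW // (linear0 (tower_shift i f V k)).
by rewrite (linear0 (tower_map i f action_map k.+1)) subrr.
Qed.

Lemma tensor_delta_linear : linear tensor_delta_fun.
Proof.
have E0 z : proj 0%N (tensor_delta_fun z) = - action_map (proj 0%N z).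
  exact: sub0r.
have ES z k : proj k.+1 (tensor_delta_fun z) = tower_shift i f V k (proj k z)
    - tower_map i f action_map k.+1 (proj k.+1 z) by [].
move=> a x y; apply: projP => k; rewrite [RHS]linearP.
case: k => [|k].
  by rewrite !E0 (linearP (proj 0%N)) (linearP action_map) opprD scalerN.
rewrite !ES !(linearP (proj _)) (linearP (tower_shift i f V k)).
by rewrite (linearP (tower_map i f action_map k.+1)) scalerBr opprD addrACA.
Qed.

Definition tensor_delta : {linear tensor_module (twist V) -> tensor_module V} :=
  linear_pack tensor_delta_linear.

Lemma proj_delta0 x : proj 0%N (tensor_delta x) = - action_map (proj 0%N x).
Proof. exact: sub0r. Qed.

Lemma proj_deltaS x k : proj k.+1 (tensor_delta x)
  = tower_shift i f V k (proj k x) - tower_map i f action_map k.+1 (proj k.+1 x).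
Proof. by []. Qed.

(** Commutation with t is what promotes [tensor_delta] from an [R]-linear to a ZL-linear map. *)
Lemma tensor_delta_shift x :
  tensor_delta (tensor_shift _ x) = tensor_shift _ (tensor_delta x).
Proof.
apply: projP => -[|[|k]].
- by rewrite proj_delta0 !proj_shift0 linear0 oppr0.
- rewrite proj_deltaS !proj_shiftS proj_shift0 linear0 sub0r proj_delta0.
  rewrite [tower_map _ _ _ _ _]twist_map_pure.
  by rewrite [RHS]twist_pureN.
rewrite proj_deltaS !proj_shiftS proj_deltaS.
rewrite [tower_shift _ _ _ _ _]twist_map_pure.
rewrite [tower_map _ _ _ _ _]twist_map_pure.
by rewrite [RHS]twist_pureB.
Qed.

(** The familiar formula t (x) v - 1 (x) t v on generators, seen in F V as ZL (x)_R V. *)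
Lemma tensor_delta_unit v :
  tensor_delta (tensor_unit _ (twist_pure v))
    = tensor_shift _ (tensor_unit V v) - tensor_unit V (tau v).
Proof.
apply: projP => k; rewrite linearB; case: k => [|[|k]].
- by rewrite proj_delta0 proj_shift0 !proj_head0 action_map_pure sub0r.
- by rewrite proj_deltaS proj_shiftS !proj_headS !linear0.
rewrite proj_deltaS proj_shiftS !proj_headS (linear0 (tower_shift i f V k.+1)).
rewrite (linear0 (tower_map i f action_map k.+2)); congr (_ - _).
by rewrite twist_pure0.
Qed.

(* The top component of x reappears alone in the top degree of delta x, so x
   vanishes by descending induction on the degree. *)
Lemma tensor_delta_inj x : tensor_delta x = 0 -> x = 0.
Proof.
move=> dx0; have [n xn] := proj_finite x.
suff x0 m k : (n <= k + m)%N -> proj k x = 0.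
  by apply: projP => k; rewrite linear0; apply: (x0 n); exact: leq_addl.
elim: m k => [|m IHm] k; first by rewrite addn0; exact: xn.
rewrite addnS -addSn => /IHm xk0.
have: proj k.+1 (tensor_delta x) = 0 by rewrite dx0 linear0.
rewrite proj_deltaS xk0 linear0 subr0 => sx0.
by rewrite -[LHS](tower_shiftK) sx0 linear0.
Qed.

Lemma tensor_counit_delta x : tensor_counit (tensor_delta x) = 0.
Proof.
move: x; apply: tensor_module_ind => [|u|x xP].
- split=> [|a x y xP yP]; first by rewrite !linear0.
  by rewrite !linearP xP yP scaler0 addr0.
- move: u; apply: twist_ind => [|v].
    split=> [|a x y xP yP]; first by rewrite !linear0.
    by rewrite !linearP xP yP scaler0 addr0.
  rewrite tensor_delta_unit linearB.
  rewrite [X in X - _]tensor_module_lift_shift.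
  by rewrite !tensor_module_lift_tensor_unit subrr.
by rewrite tensor_delta_shift [LHS]tensor_module_lift_shift xP linear0.
Qed.

(** Modulo the image of [tensor_delta], t v agrees with [tau v], so every element of F V is
    congruent to one of degree 0. There the counit is the identity, so an element of the kernel has
    degree-0 part 0. *)
Lemma tensor_delta_exact : exact_at tensor_delta tensor_counit.
Proof.
have decomp y : exists x v, y = tensor_delta x + tensor_unit V v.
  move: y; apply: tensor_module_ind => [|w|_ [x [v ->]]].
  - split=> [|a _ _ [x [v ->]] [x' [v' ->]]].
      by exists 0, 0; rewrite !linear0 addr0.
    by exists (a *: x + x'), (a *: v + v'); rewrite !linearP scalerDr addrACA.
  - by exists 0, w; rewrite linear0 add0r.
  (* By [tensor_delta_unit], the shift of [tensor_unit V v] is [tensor_unit V (tau v)] plus the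
     value of [tensor_delta] on the second summand. *)
  exists (tensor_shift _ x + tensor_unit _ (twist_pure v)), (tau v).
  rewrite (linearD tensor_delta) tensor_delta_unit tensor_delta_shift -addrA subrK.
  exact: (linearD (tensor_shift V)).
move=> y; split=> [|[x <-]]; last exact: tensor_counit_delta.
have [x [v ->]] := decomp y.
rewrite linearD tensor_counit_delta add0r [LHS]tensor_module_lift_tensor_unit => v0.
by exists x; rewrite (v0 : v = 0) linear0 addr0.
Qed.

Lemma tensor_counit_surjective : surjective_map tensor_counit.
Proof.
by move=> v; exists (tensor_unit V v); exact: tensor_module_lift_tensor_unit.
Qed.

End Sequence.
End TensorModuleLift.

(** * Modules over the Otto-Pride extension *)

Section QuotientAction.
Variables (N : monoidType) (rho : N -> N -> Prop) (V : Type) (act : N -> V -> V).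
Hypothesis act1 : forall v, act 1%g v = v.
Hypothesis actM : forall x y v, act (x * y)%g v = act x (act y v).
Hypothesis act_rel : forall x y, rho x y -> act x =1 act y.

Definition quotient_act (x : monoid_quot rho) : V -> V := act (repr x).

(** The pairs acting identically form a congruence containing [rho], so the chosen representative is
    immaterial. This is used twice: from words to the free product, then to L. *)
Lemma quotient_act_pi x v : quotient_act (monoid_pi rho x) v = act x v.
Proof.
have: congruence_gen rho (repr (monoid_pi rho x)) x.
  by apply/monoid_piP; rewrite monoid_pi_repr.
rewrite /quotient_act; move: (repr _) => y cyx.
elim: cyx v => {x y} [x y /act_rel|//|x y _ IH v|x y z _ IH _ IH' v|].
- by [].
- by rewrite IH.
- by rewrite IH IH'.
by move=> x x' y y' _ IH _ IH' v; rewrite !actM IH' IH.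
Qed.

Lemma quotient_act1 v : quotient_act 1%g v = v.
Proof. by rewrite [LHS]quotient_act_pi act1. Qed.

Lemma quotient_actM x y v :
  quotient_act (x * y)%g v = quotient_act x (quotient_act y v).
Proof.
by rewrite -[x]monoid_pi_repr -[y]monoid_pi_repr -gmulfM !quotient_act_pi actM.
Qed.

End QuotientAction.

Lemma monoid_ring_ind (N : monoidType) (P : monoid_ring N -> Prop) :
    P 0 -> (forall x y, P x -> P y -> P (x - y)) -> (forall a, P << a >>) ->
  forall x, P x.
Proof. exact: malg_zmod_ind. Qed.

Section MonoidScale.
Variables (N : monoidType) (V : zmodType) (act : N -> V -> V).
Hypothesis act1 : forall v, act 1%g v = v.
Hypothesis actM : forall x y v, act (x * y)%g v = act x (act y v).
Hypothesis actB : forall x, zmod_morphism (act x).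

Definition monoid_scale (r : monoid_ring N) (v : V) : V :=
  malg_lift (act^~ v) r.

Lemma monoid_scaleU a v : monoid_scale << a >> v = act a v.
Proof. exact: malg_liftU1. Qed.

Lemma monoid_scaleBl v : zmod_morphism (monoid_scale^~ v).
Proof. by move=> r s; rewrite /monoid_scale; exact: raddfB. Qed.

Lemma monoid_scale0l v : monoid_scale 0 v = 0.
Proof. by have := monoid_scaleBl v 0 0; rewrite !subrr. Qed.

Lemma monoid_scaleBr r : zmod_morphism (monoid_scale r).
Proof.
move=> u v; elim/monoid_ring_ind: r => [|r s Hr Hs|a].
- by rewrite !monoid_scale0l subrr.
- by rewrite !monoid_scaleBl Hr Hs !opprD addrACA.
by rewrite !monoid_scaleU actB.
Qed.

Lemma monoid_scale0r r : monoid_scale r 0 = 0.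
Proof. by have := monoid_scaleBr r 0 0; rewrite !subrr. Qed.

Lemma monoid_scaleA r s v :
  monoid_scale r (monoid_scale s v) = monoid_scale (r * s) v.
Proof.
elim/monoid_ring_ind: r => [|r r' Hr Hr'|a].
- by rewrite mul0r !monoid_scale0l.
- by rewrite mulrBl !monoid_scaleBl Hr Hr'.
elim/monoid_ring_ind: s => [|s s' Hs Hs'|b].
- by rewrite mulr0 !monoid_scale0l monoid_scale0r.
- by rewrite mulrBr !monoid_scaleBl monoid_scaleBr Hs Hs'.
by rewrite [_ * _]monoid_ring_mulUU !monoid_scaleU actM.
Qed.

Lemma monoid_scale1 : left_id 1 monoid_scale.
Proof. by move=> v; rewrite [LHS]monoid_scaleU act1. Qed.

Lemma monoid_scaleDr : right_distributive monoid_scale +%R.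
Proof.
move=> r u v; rewrite -{1}[v]opprK monoid_scaleBr -[- v]sub0r monoid_scaleBr.
by rewrite monoid_scale0r sub0r opprK.
Qed.

Lemma monoid_scaleDl v : {morph monoid_scale^~ v : r s / r + s}.
Proof.
move=> r s; rewrite -{1}[s]opprK monoid_scaleBl -[- s]sub0r monoid_scaleBl.
by rewrite monoid_scale0l sub0r opprK.
Qed.

End MonoidScale.

Lemma monoid_ring_mapU (M N : monoidType) (g : {monhom M -> N}) a :
  monoid_ring_map g << a >> = << g a >>.
Proof. exact: malg_liftU1. Qed.

Lemma augmentation_map (M N : monoidType) (g : {monhom M -> N}) r :
  augmentation (monoid_ring_map g r) = augmentation r.
Proof.
elim/monoid_ring_ind: r => [|r s Hr Hs|a]; first by rewrite !rmorph0.
  by rewrite !rmorphB; congr (_ - _).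
by rewrite monoid_ring_mapU [LHS]malg_liftU1 [RHS]malg_liftU1.
Qed.

(** * The monoid ring of the extension and its modules *)

Section OttoPrideRing.
Variables (M : monoidType) (S : pred M) (A : subMonoidType S).
Variable phi : {monhom A -> M}.

Local Notation B := (monoid_ring A).
Local Notation R := (monoid_ring M).
Local Notation L := (otto_pride phi).
Local Notation RL := (monoid_ring L).

Definition op_incl : {rmorphism B -> R} := monoid_ring_map (val : A -> M).
Definition op_phi : {rmorphism B -> R} := monoid_ring_map phi.

Definition op_base (m : M) : L :=
  monoid_pi (otto_pride_rel phi) (free_product_inl _ m).

Lemma op_base_morphism : monoid.monoid_morphism op_base.
Proof. by split=> [|x y]; rewrite /op_base ?gmulf1 // gmulfM gmulfM. Qed.

HB.instance Definition _ :=
  isUMagmaMorphism.Build M L op_base op_base_morphism.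

Definition op_embed : {rmorphism R -> RL} := monoid_ring_map op_base.

Definition op_stable : L := monoid_pi (otto_pride_rel phi) (op_t M).
Definition op_tau : RL := << op_stable >>.

Lemma op_embedU m : op_embed << m >> = << op_base m >>.
Proof. exact: monoid_ring_mapU. Qed.

Lemma op_tau_comm b : op_embed (op_incl b) * op_tau = op_tau * op_embed (op_phi b).
Proof.
elim/monoid_ring_ind: b => [|b c Hb Hc|a]; first by rewrite !rmorph0 mul0r mulr0.
  by rewrite !rmorphB mulrBl mulrBr Hb Hc.
rewrite [op_incl _]monoid_ring_mapU [op_phi _]monoid_ring_mapU !op_embedU.
rewrite [LHS]monoid_ring_mulUU [RHS]monoid_ring_mulUU; congr << _ >>.
rewrite /op_base /op_stable -!gmulfM.
exact/monoid_piP/cg_rel/op_rel.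
Qed.

(** The ring ZL is generated by the image of ZM and by t, since each element of L is represented by
    a word in M and powers of t. *)
Lemma op_ring_ind (P : RL -> Prop) :
    (forall r, P (op_embed r)) -> P op_tau ->
    (forall x y, P x -> P y -> P (x - y)) ->
    (forall x y, P x -> P y -> P (x * y)) ->
  forall x, P x.
Proof.
move=> Pr Pt PB PM.
have PU (x y : L) : P << x >> -> P << y >> -> P << (x * y)%g >>.
  by move=> Px Py; have := PM _ _ Px Py; rewrite [_ * _]monoid_ring_mulUU.
have Pbase m : P << op_base m >> by rewrite -op_embedU; exact: Pr.
have P1 : P << 1%g >> by have := Pbase 1%g; rewrite gmulf1.
apply: monoid_ring_ind => [||l]; first by rewrite -(rmorph0 op_embed); exact: Pr.
  exact: PB.
(* Two representatives are taken because L is a quotient of the free product, itself a quotient of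
   the monoid of words. *)
rewrite -[l]monoid_pi_repr -[repr l]monoid_pi_repr.
elim: (repr (repr l)) => [|c w IHw]; first exact: P1.
rewrite -[c :: w]/(([:: c] : free_monoid (M + free_monoid unit)) * w)%g.
rewrite gmulfM gmulfM; apply: (PU _ _ _ IHw); case: c => [m|s]; first exact: Pbase.
change (P << monoid_pi (otto_pride_rel phi) (free_product_inr M s) >>).
elim: s => [|[] s IHs]; first by rewrite gmulf1 gmulf1; exact: P1.
rewrite -[tt :: s]/(([:: tt] : free_monoid unit) * (s : free_monoid unit))%g.
rewrite gmulfM gmulfM.
exact: PU Pt IHs.
Qed.

(** The scalars commuting with the additive map [h] are closed under differences and products, so it
    is enough to test ZM and t. *)
Lemma op_linear (X Y : lmodType RL) (h : X -> Y) :
    linear (h : restriction op_embed X -> restriction op_embed Y) ->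
    (forall x, h (op_tau *: x) = op_tau *: h x) ->
  linear h.
Proof.
move=> hL ht; have hD x y : h (x + y) = h x + h y.
  by have := hL 1 x y; rewrite !scale1r.
have h0 : h 0 = 0 by apply: (addrI (h 0)); rewrite -hD !addr0.
have hB x y : h (x - y) = h x - h y.
  by apply: (addIr (h y)); rewrite -hD !subrK.
move=> a x y; rewrite hD; congr (_ + _).
elim/op_ring_ind: a x => [r|//|a b Ha Hb|a b Ha Hb] x.
- by have := hL r x 0; rewrite !restrictionE addr0 h0 addr0.
- by rewrite !scalerBl hB Ha Hb.
by rewrite -!scalerA Ha Hb.
Qed.

Section Module.
Variables (V : lmodType R).
Variable tau : {linear restriction op_phi V -> restriction op_incl V}.

Local Notation word := (free_monoid (M + free_monoid unit)).

(** An element of [free_monoid unit] is a power of t whose exponent is its length. *)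
Definition letter_act (c : M + free_monoid unit) (v : V) : V :=
  match c with inl m => (<< m >> : R) *: v | inr s => iter (size s) tau v end.

Definition word_act (w : word) (v : V) : V := foldr letter_act v w.

Lemma word_actM (x y : word) v : word_act (x * y)%g v = word_act x (word_act y v).
Proof. exact: foldr_cat. Qed.

Lemma word_act_rel x y : free_product_rel x y -> word_act x =1 word_act y.
Proof.
case=> [||m m'|s s'] v //=; first exact: scale1r.
  by rewrite scalerA [_ * _]monoid_ring_mulUU.
by rewrite -iterD -size_cat.
Qed.

Lemma word_actB x : zmod_morphism (word_act x).
Proof.
elim: x => [|c x IHx] u v //=; rewrite IHx; case: c => [m|s] /=.
  exact: scalerBr.
elim: (size s) => [|k IHk] //=; rewrite IHk.
exact: (linearB tau).
Qed.

Definition free_product_act : free_product M (free_monoid unit) -> V -> V :=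
  quotient_act word_act.

Lemma free_product_act_pi w v :
  free_product_act (monoid_pi _ w) v = word_act w v.
Proof. exact: (quotient_act_pi word_actM word_act_rel). Qed.

Lemma free_product_act1 v : free_product_act 1%g v = v.
Proof. exact: (quotient_act1 _ word_actM word_act_rel). Qed.

Lemma free_product_actM x y v :
  free_product_act (x * y)%g v = free_product_act x (free_product_act y v).
Proof. exact: (quotient_actM word_actM word_act_rel). Qed.

(** The defining relation of L holds precisely because [tau] is linear between the two restrictions
    to ZA. *)
Lemma free_product_act_rel x y :
  otto_pride_rel phi x y -> free_product_act x =1 free_product_act y.
Proof.
case=> a v; rewrite !free_product_actM !free_product_act_pi /=.
rewrite -(monoid_ring_mapU phi) -(monoid_ring_mapU (val : A -> M)).
exact: (esym (linearZ_LR tau << a >> v)).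
Qed.

Definition op_act : L -> V -> V := quotient_act free_product_act.

Lemma op_act_pi x v : op_act (monoid_pi _ x) v = free_product_act x v.
Proof. exact: (quotient_act_pi free_product_actM free_product_act_rel). Qed.

Lemma op_act1 v : op_act 1%g v = v.
Proof.
exact: (quotient_act1 free_product_act1 free_product_actM free_product_act_rel).
Qed.

Lemma op_actM x y v : op_act (x * y)%g v = op_act x (op_act y v).
Proof. exact: (quotient_actM free_product_actM free_product_act_rel). Qed.

Lemma op_actB x : zmod_morphism (op_act x).
(* Both quotient actions unfold to the action of a chosen word. *)
Proof. exact: word_actB. Qed.

End Module.

Definition op_module (V : lmodType R)
  (tau : {linear restriction op_phi V -> restriction op_incl V}) : Type := V.

Section OpModule.
Variables (V : lmodType R).
Variable tau : {linear restriction op_phi V -> restriction op_incl V}.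

HB.instance Definition _ := GRing.Zmodule.on (op_module tau).

HB.instance Definition _ := GRing.Zmodule_isLmodule.Build RL (op_module tau)
  (monoid_scaleA (op_actM tau) (op_actB tau)) (monoid_scale1 (op_act1 tau))
  (monoid_scaleDr (op_actB tau)) (monoid_scaleDl (op_act tau)).

Lemma op_module_embed r (v : op_module tau) :
  op_embed r *: v = (r *: (v : V)) :> V.
Proof.
elim/monoid_ring_ind: r => [|r s Hr Hs|m]; first by rewrite rmorph0 !scale0r.
  by rewrite rmorphB scalerBl [RHS]scalerBl; congr (_ - _).
rewrite op_embedU [LHS]monoid_scaleU op_act_pi.
exact: free_product_act_pi.
Qed.

Lemma op_module_tau (v : op_module tau) : op_tau *: v = tau v.
Proof. by rewrite [LHS]monoid_scaleU op_act_pi; exact: free_product_act_pi. Qed.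

End OpModule.

Section TauAction.
Variable V : lmodType RL.

(** The passage opposite to [op_module]: a ZL-module yields a ZM-module with a twisted endomorphism,
    by [op_tau_comm]. *)
Lemma tau_action_linear : linear ((fun v : V => op_tau *: v) :
  restriction op_phi (restriction op_embed V) ->
  restriction op_incl (restriction op_embed V)).
Proof.
move=> b u v; rewrite [LHS](scalerDr op_tau (_ : V) (_ : V)); congr (_ + _).
have comm : op_tau *: (op_embed (op_phi b) *: (u : V))
    = op_embed (op_incl b) *: (op_tau *: (u : V)).
  by rewrite !scalerA op_tau_comm.
exact: comm.
Qed.

Definition tau_action :
  {linear restriction op_phi (restriction op_embed V) ->
          restriction op_incl (restriction op_embed V)} :=
  linear_pack tau_action_linear.

End TauAction.
End OttoPrideRing.

(** * The functor F with values in ZL-modules *)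

Section OttoPrideResolution.
Variables (M : monoidType) (S : pred M) (A : subMonoidType S).
Variable phi : {monhom A -> M}.

Local Notation B := (monoid_ring A).
Local Notation R := (monoid_ring M).
Local Notation RL := (monoid_ring (otto_pride phi)).
Local Notation incl := (op_incl A).
Local Notation embed := (op_embed phi).
Local Notation tau := (op_tau phi).
Local Notation fmap := (op_phi phi).

Definition op_free (W : lmodType R) : lmodType RL :=
  op_module (tensor_shift incl fmap W).

Lemma op_free_linear (W W' : lmodType R)
    (h : {linear tensor_module incl fmap W -> tensor_module incl fmap W'}) :
    (forall x, h (tensor_shift incl fmap W x) = tensor_shift incl fmap W' (h x)) ->
  linear (h : op_free W -> op_free W').
Proof.
move=> ht; apply: op_linear => [r x y|x]; last first.
  by rewrite !op_module_tau; exact: ht.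
rewrite !restrictionE !op_module_embed; exact: (linearP h).
Qed.

Definition op_free_map (W W' : lmodType R) (g : {linear W -> W'}) :
    {linear op_free W -> op_free W'} :=
  linear_pack (op_free_linear (tensor_module_map_shift g)).

Lemma op_free_unit_linear (W : lmodType R) :
  linear (tensor_unit incl fmap W : W -> restriction embed (op_free W)).
Proof.
move=> r x y; rewrite restrictionE op_module_embed.
exact: (linearP (tensor_unit _ _ W)).
Qed.

Definition op_free_unit (W : lmodType R) :
    {linear W -> restriction embed (op_free W)} :=
  linear_pack (@op_free_unit_linear W).

Lemma op_lift_linear (W : lmodType R) (V : lmodType RL)
    (g : {linear W -> restriction embed V}) :
  linear (tensor_module_lift g (tau_action V) : op_free W -> V).
Proof.
apply: op_linear => [r x y|x]; last first.
  by rewrite op_module_tau; exact: (tensor_module_lift_shift g (tau_action V)).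
rewrite !restrictionE op_module_embed.
exact: (linearP (tensor_module_lift g (tau_action V))).
Qed.

(** This gives [op_free W] the universal property of ZL (x)_R W, so projectivity and finite
    generation pass from [W] without describing ZL over ZM. *)
Lemma op_free_extension (W : lmodType R) : is_extension (op_free_unit W).
Proof.
split=> [V g|P subP Pu].
  exists (linear_pack (op_lift_linear g)) => w.
  exact: (tensor_module_lift_tensor_unit g (tau_action V)).
apply: tensor_module_ind => [|//|x Px].
  split=> [|r x y Px Py]; first exact: (submodule0 subP).
  have Prx : P (embed r *: (x : op_free W)) by exact: submoduleZ.
  rewrite op_module_embed in Prx.
  exact: (submoduleD subP Prx Py).
by have := submoduleZ subP tau Px; rewrite op_module_tau.
Qed.

Lemma op_free_resolution (W : lmodType R) (P : nat -> lmodType R)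
    (d : forall k, {linear P k.+1 -> P k}) (e : {linear P 0%N -> W}) :
    flat (right_module_along incl) -> projective_resolution d e ->
  projective_resolution (fun k => op_free_map (d k)) (op_free_map e).
Proof.
move=> flati [projP eS ex0 ex]; split.
- by move=> k; exact: (is_extension_projective (op_free_extension (P k))).
- exact: tensor_module_map_surjective.
- exact: tensor_module_map_exact.
- by move=> k; exact: tensor_module_map_exact.
Qed.

Definition op_delta (V : lmodType RL) :
    {linear op_free (twist incl fmap (restriction embed V)) ->
            op_free (restriction embed V)} :=
  linear_pack (op_free_linear (tensor_delta_shift (tau_action V))).

Definition op_counit (V : lmodType RL) :
    {linear op_free (restriction embed V) -> V} :=
  linear_pack (op_lift_linear (idfun : {linear restriction embed V -> _})).

End OttoPrideResolution.

(** * Assembling the resolution of the trivial module *)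

Lemma restriction_trivial (N N' : monoidType) (g : {monhom N -> N'}) r
    (z : trivial_module N') :
  monoid_ring_map g r *: z = (r *: (z : trivial_module N)) :> int.
Proof.
rewrite -[LHS]/(augmentation (monoid_ring_map g r) * (z : int)) augmentation_map.
by [].
Qed.

Lemma induced_resolution (B R : pzRingType) (i : {rmorphism B -> R})
    (Y : lmodType B) (Q : nat -> lmodType B)
    (d : forall k, {linear Q k.+1 -> Q k}) (e : {linear Q 0%N -> Y}) :
    flat (right_module_along i) -> projective_resolution d e ->
  projective_resolution (P := fun k => induced i (Q k))
    (fun k => induced_map i (d k)) (induced_map i e).
Proof.
move=> flati [projQ eS ex0 ex]; split.
- by move=> k; exact: (is_extension_projective (induced_extension i (Q k))).
- exact: induced_map_surjective.
- exact: induced_map_exact.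
- by move=> k; exact: induced_map_exact.
Qed.

Theorem theorem5p8 (M : monoidType) (S : pred M) (A : subMonoidType S)
    (phi : {monhom A -> M}) (n : natbar) :
  flat (right_module_along (monoid_ring_map (val : A -> M))) ->
  le_natbar 1 n ->
  left_FP n M ->
  left_FP (natbar_pred n) A ->
  left_FP n (otto_pride phi).
Proof.
move=> flati n_gt0 [P [dP [eP [resP fgP]]]] [Q [dQ [eQ [resQ fgQ]]]].
pose Z : lmodType (monoid_ring (otto_pride phi)) :=
  trivial_module (otto_pride phi).
pose ZM : lmodType (monoid_ring M) := restriction (op_embed phi) Z.
(* Monoid homomorphisms preserve augmentations, so the trivial ZL-module restricts to the trivial
   modules over ZM and ZA, and both augmentation maps can be reread with the restricted targets. *)
have eP'L : linear (eP : P 0%N -> ZM).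
  move=> r x y; rewrite [LHS]linearP; congr (_ + _).
  exact: (esym (restriction_trivial (op_base phi) r (eP x))).
have eQ'L : linear (eQ : Q 0%N -> restriction (op_phi phi) ZM).
  move=> r x y; rewrite [LHS]linearP; congr (_ + _).
  rewrite restrictionE -[RHS]/(op_embed phi (op_phi phi r) *: (eQ x : Z)).
  rewrite [RHS](restriction_trivial (op_base phi)).
  exact: (esym (restriction_trivial phi r (eQ x))).
have resP' : projective_resolution dP (linear_pack eP'L) by exact: resP.
have resQ' : projective_resolution dQ (linear_pack eQ'L) by exact: resQ.
have resFP := op_free_resolution phi flati resP'.
(* Here T Z is Z, a ZA-module through [phi], induced along the inclusion; hence [Q] is induced to ZM
   first and then extended to ZL. *)
have resFQ := op_free_resolution phi flati (induced_resolution flati resQ').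
pose delta := op_delta Z; pose eps := op_counit Z.
have delta_inj u : delta u = 0 -> u = 0 by exact: tensor_delta_inj.
have ex_mid : exact_at delta eps by exact: tensor_delta_exact.
have eps_surj : surjective_map eps by exact: tensor_counit_surjective.
do 3!eexists; split.
  exact: (cone_resolution delta_inj ex_mid eps_surj resFQ resFP).
move=> k kn; apply: cone_finitely_generated => j jk.
  apply: (is_extension_finitely_generated (op_free_extension phi (P j))).
  apply: fgP; case: n kn {n_gt0 fgQ} => //= m; exact: leq_trans.
apply: (is_extension_finitely_generated (op_free_extension phi (induced _ (Q j)))).
apply: (is_extension_finitely_generated (induced_extension _ (Q j))).
(* For finite [n = m], the bound j < k <= m gives j <= m - 1; it also makes [m] positive, so the
   truncated predecessor is a true one. *)
apply: fgQ; case: n kn {n_gt0 fgP} => //= m km.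
have jm := leq_trans jk km.
by rewrite -ltnS prednK // (leq_ltn_trans (leq0n j)).
Qed.
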